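(* Let $\{\boldsymbol{Z}_n\}$ be an irreducible, non-singular lower Hessenberg branching process with $M_{i,i+1}>0$ for all $i\ge 0$, satisfying the dichotomy condition (D), and suppose that $\sum_{i=0}^\infty(1-p_i^{(1)})=\infty$, where $p_i^{(1)}=\sum_{\boldsymbol v:|\boldsymbol v|=1}p_i(\boldsymbol v)$. Let $S=\{\boldsymbol{s}\in[0,1]^{\mathcal X}:\boldsymbol{s}=\boldsymbol{G}(\boldsymbol{s})\}$. If $\boldsymbol s\in S\setminus\{\boldsymbol 1\}$ and there exists a growth rate $\{C_k\}_{k\ge0}$ of the embedded process $\{Y_k\}$ such that $g_{W(\{C_k\})}(0)<s_0<g_{W(\{C_k\})}(1)$, then $$\lim_{k\to\infty}(1-s_k)\,C_k=c\in(0,\infty),$$ where $c$ is such that $s_0=g_{W(\{C_k\})}(e^{-c})$.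
   Context: Lower Hessenberg branching process (LHBP): a multitype Galton-Watson process with type set $\mathcal X=\mathbb N_0=\{0,1,2,\dots\}$, started from a single individual of type $\varphi_0$. Each individual lives one generation; independently of all others, an individual of type $i$ has at death $r_\ell$ children of type $\ell$ ($\ell\in\mathcal X$) with probability $p_i(\boldsymbol r)$, where $\boldsymbol r\in R_i:=\{\boldsymbol r\in\mathbb N_0^{\mathcal X}: r_\ell=0\ \forall \ell>i+1\}$. $\boldsymbol Z_n=(Z_{n,\ell})_{\ell\in\mathcal X}$ counts the individuals of each type in generation $n$. Progeny generating vector: $G_i(\boldsymbol s)=\sum_{\boldsymbol r\in R_i}p_i(\boldsymbol r)\prod_{k=0}^{i+1}s_k^{r_k}$, $\boldsymbol s\in[0,1]^{\mathcal X}$. Mean progeny matrix: $M_{i,j}=\partial G_i/\partial s_j$ at $\boldsymbol s=\boldsymbol 1$. $|\boldsymbol v|=\sum_\ell v_\ell$. Irreducible: in the directed graph on $\mathcal X$ with an edge $i\to j$ iff $M_{i,j}>0$ there is a path between any two vertices. Non-singular: there is $i$ with $\sum_{|\boldsymbol v|=1}p_i(\boldsymbol v)<1$. Process with sterile types: for $k\ge -1$, $\{\tilde{\boldsymbol Z}^{(k)}_n\}$ is obtained from $\{\boldsymbol Z_n\}$ by removing all descendants of individuals of type $>k$ (individuals of type $>k$ themselves are kept but have no children). Process with immortal types: $\{\boldsymbol Z^{(k)}_n\}$ is obtained by replacing instead the descendants of every individual of type $i>k$ by an infinite line of type-$i$ descendants (one in each generation). Embedded process: $Y_k=\sum_{n=0}^\infty\tilde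 Z^{(k-1)}_{n,k}\in\mathbb N_0\cup\{\infty\}$ for $k\ge\varphi_0$ (so $Y_{\varphi_0}=1$). $\mathbb P_i,\mathbb E_i$ denote probability and expectation when $\varphi_0=i$ (equivalently $Y_i=1$). Condition (D): for all $k\ge 0$, $\mathbb P_k(\lim_n\sum_{i=0}^k Z^{(k)}_{n,i}=0)+\mathbb P_k(\lim_n\sum_{i=0}^k Z^{(k)}_{n,i}=\infty)=1$. Growth rate: a sequence of real numbers $\{C_k\}_{k\ge0}$ such that, with $\varphi_0=0$, $\lim_{k\to\infty}Y_k/C_k=W(\{C_k\})$ exists almost surely, where $W(\{C_k\})$ is a non-negative random variable, possibly defective (it may take the value $\infty$ with positive probability), with $\mathbb P_0(0<W(\{C_k\})<\infty)>0$. Its generating function is $g_{W(\{C_k\})}(z)=\mathbb E_0\big(z^{W(\{C_k\})}\mathbf 1\{W(\{C_k\})<\infty\}\big)$, $z\in[0,1]$ (with $0^0=1$). *)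

(* Defs.v *)
From HB Require Import structures.
From mathcomp Require Import all_boot all_order all_algebra.
From mathcomp Require Import all_classical all_reals all_analysis.
From mathcomp Require Import measurable_realfun.
Set Implicit Arguments.
Unset Strict Implicit.
Unset Printing Implicit Defensive.
Import Order.TTheory GRing.Theory Num.Theory.
Import numFieldNormedType.Exports.
Local Open Scope classical_set_scope.
Local Open Scope ring_scope.

(* The set R_i of offspring configurations of a type-i individual. *)
Definition offspring_set (i : nat) : set (nat -> nat) :=
  [set r | forall l, (i.+1 < l)%N -> r l = 0%N].

(* |r|; every r in R_i vanishes beyond i+1, so the sum is cut off there. *)
Definition offspring_size (i : nat) (r : nat -> nat) : nat :=
  (\sum_(l < i.+2) r l)%N.

Section OffspringLaw.
Context {R : realType}.
Implicit Types (p : nat -> (nat -> nat) -> R) (s : nat -> R).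

(* Only the values of p i on R_i are meaningful. *)
Definition offspring_law p : Prop :=
  (forall i r, offspring_set i r -> 0 <= p i r) /\
  (forall i, \esum_(r in offspring_set i) (p i r)%:E = 1%E).

Definition pgf p (i : nat) s : \bar R :=
  \esum_(r in offspring_set i) (p i r * \prod_(k < i.+2) s k ^+ r k)%:E.

(* Since G_i lives on [0,1]^X, its partial derivative at 1 is the left one; it
   may be +oo. *)
Definition mean_progeny p (i j : nat) : \bar R :=
  lim ((pgf p i (fun=> 1%R) - pgf p i (fun l => if l == j then 1 - h else 1)%R)
       * (h^-1)%:E @[h --> (0 : R)^'+])%E.

Definition irreducible_law p : Prop :=
  forall i j, exists w : seq nat,
    path (fun a b => 0 < mean_progeny p a b)%E i w /\ last i w = j.

Definition p1 p (i : nat) : \bar R :=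
  \esum_(v in [set v | offspring_set i v /\ offspring_size i v = 1%N])
    (p i v)%:E.

Definition nonsingular_law p : Prop := exists i, (p1 p i < 1)%E.

Definition fixed_points p : set (nat -> R) :=
  [set s | (forall i, 0 <= s i <= 1) /\ (forall i, (s i)%:E = pgf p i s)].

End OffspringLaw.

(* Ulam-Harris labels: (i0, [:: (l1, j1); ...; (ln, jn)]) is the j_n-th child
   of type l_n of the ... of the j_1-th child of type l_1 of the root, which has
   type i0 (children of each type are numbered from 0). *)
Definition label : Type := (nat * seq (nat * nat))%type.

Definition type_of (u : label) : nat := last u.1 (unzip1 u.2).

(* In the next four definitions, off u l is the number of type-l children of
   the individual u. *)
Definition children (off : label -> nat -> nat) (u : label) : seq label :=
  [seq (u.1, rcons u.2 (l, j)) | l <- iota 0 (type_of u).+2,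
                                 j <- iota 0 (off u l)].

Definition generation (off : label -> nat -> nat) (i0 n : nat) : seq label :=
  iter n (fun us => flatten (map (children off) us)) [:: (i0, [::])].

(* Z_{n,l}, for a root of type i0. *)
Definition Z (off : label -> nat -> nat) (i0 n l : nat) : nat :=
  count (fun u => type_of u == l) (generation off i0 n).

Definition sterile (k : int) (off : label -> nat -> nat) : label -> nat -> nat :=
  fun u => if (k < (type_of u)%:Z)%R then (fun=> 0%N) else off u.

Definition immortal (k : int) (off : label -> nat -> nat) :
    label -> nat -> nat :=
  fun u => if (k < (type_of u)%:Z)%R then (fun l => (l == type_of u) : nat)
           else off u.

Section Process.
Context {R : realType} {d : measure_display} {T : measurableType d}.
Implicit Types (P : probability T R) (X : label -> T -> nat -> nat).

(* X u w is the offspring of u in the outcome w: the X u are independent, and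
   X u has law p_i on R_i, i being the type of u. The labels cover roots of all
   types, so that, on this one space, P_i is the probability P of an event on
   the tree with root type i. *)
Definition LHBP (p : nat -> (nat -> nat) -> R) P X : Prop :=
  [/\ forall u w, offspring_set (type_of u) (X u w),
      forall u r, measurable (X u @^-1` [set r]),
      forall u r, offspring_set (type_of u) r ->
        P (X u @^-1` [set r]) = (p (type_of u) r)%:E
    & forall (us : seq label) (A : label -> set (nat -> nat)), uniq us ->
        P (\bigcap_(u in [set` us]) (X u @^-1` A u)) =
        (\prod_(u <- us) P (X u @^-1` A u))%E].

(* sum_{i <= k} Z^{(k)}_{n,i}, started from type k *)
Definition low_types X (k n : nat) (w : T) : \bar R :=
  ((\sum_(i < k.+1) Z (immortal k%:Z (X^~ w)) k n i)%N%:R)%:E.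

Definition dichotomy P X : Prop :=
  forall k : nat,
    (P [set w | low_types X k n w @[n --> \oo] --> 0%E] +
     P [set w | low_types X k n w @[n --> \oo] --> +oo%E] = 1)%E.

(* Y_k, for a root of type i0 *)
Definition embedded X (i0 k : nat) (w : T) : \bar R :=
  (\sum_(0 <= n <oo) (Z (sterile (k%:Z - 1) (X^~ w)) i0 n k)%:R%:E)%E.

(* C is a growth rate with limit W. *)
Definition growth_rate P X (C : nat -> R) (W : T -> \bar R) : Prop :=
  [/\ measurable_fun setT W,
      forall w, (0 <= W w)%E,
      {ae P, forall w,
        (embedded X 0 k w * ((C k)^-1)%:E)%E @[k --> \oo] --> W w}
    & (0 < P [set w | 0 < W w < +oo])%E].

Definition gW P (W : T -> \bar R) (z : R) : \bar R :=
  (\int[P]_(w in [set w | W w < +oo]) (z `^ fine (W w))%:E)%E.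

End Process.

(* Main.v *)
(* Write E_i[y^(Y_K)] = H_K(y)_i. It is the limit of the iterates of G with the
   types >= K frozen, started from (1, ..., 1, y). Condition (D) makes it the only
   vector below 1 which is fixed by G at the types < K and has value y at K.
   Hence every fixed point s <> 1 satisfies s_0 = E_0[s_k^(Y_k)] for all k, and
   H_K(y)_0 = H_k(H_K(y)_k)_0 for k <= K.

   Since Y_k / C_k -> W, the functions E_0[exp(- a Y_k / C_k)] converge to
   g_W(exp(- a)), which is continuous and strictly decreasing in a. If c is given
   by g_W(exp(- c)) = s_0, then exp(- b / C_k) < s_k < exp(- a / C_k) eventually
   for a < c < b, which yields the claim as soon as C_k -> oo.

   Suppose C_k has a bounded subsequence. Then, along a further subsequence, Y_k
   tends to a multiple of W, so E_k[y^(Y_K)] is close to y for k <= K large: Y_K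
   is likely to be 1 given Y_k = 1. Consequently the survival probabilities
   P_m(Y_K > 0), m <= K, are bounded below by some d > 0. Two or more children
   then lead to Y_K <> 1 with probability at least d^2, so Y_K = 1 requires a line
   of single children through all types from k to K, which has probability at
   most the product of the p_m^(1), k <= m < K. This product vanishes as K -> oo,
   because the sum of the 1 - p_m^(1) diverges: a contradiction. *)

(* Y = 1 is detected by two values of a generating function. With u = E[0^Y] and v = E[2^-Y], the
   difference v - u is E[2^-Y; Y > 0]; it is at most 1/2, and close to 1/2 only if Y = 1 is likely.
   The events Y_K = 1 thus become inequalities between two vectors fixed below K, linked by v <= (1
   + u) / 2, and no path is ever conditioned on. In the same spirit the Markov property of the
   embedded process is an identity between fixed vectors, deduced from uniqueness; uniqueness is
   where (D) enters. The obstacle in the bounded case is that H_K is known to be close to the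
   identity only at the types of a subsequence, while the single-line estimate needs a survival
   bound at every type m <= K. The bound is obtained by asking how exactly one of N lines issued
   from type m can survive: for N >= 2 this keeps v - u below 13/32 < 1/2, and for N = 1 it forces
   the extinction probability below 3/16 = 1 - 2 * 13/32. Y_k and W may be infinite, so limits are
   taken at points exp(- a) with a > 0, where an infinite exponent contributes 0. *)
Require Import Defs.
From HB Require Import structures.
From mathcomp Require Import all_boot all_order all_algebra.
From mathcomp Require Import all_classical all_reals all_analysis.
From mathcomp Require Import measurable_realfun ring lra zify.
Set Implicit Arguments.
Unset Strict Implicit.
Unset Printing Implicit Defensive.
Import Order.TTheory GRing.Theory Num.Theory.
Import numFieldNormedType.Exports.
Local Open Scope classical_set_scope.
Local Open Scope ring_scope.

(** * Bounded functions and discrete random variables *)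

Section BoundedExpectation.
Context {R : realType} {d : measure_display} {T : measurableType d}.
Context (P : probability T R).
Implicit Types (f g : T -> R).

Definition bmfun f : Prop :=
  measurable_fun setT f /\ exists M, forall w, `|f w| <= M.

Lemma bmfun_integrable f : bmfun f -> P.-integrable setT (EFin \o f).
Proof.
move=> [mf [M fM]]; apply: measurable_bounded_integrable => //.
- exact: le_lt_trans (probability_le1 P measurableT) (ltry _).
- by exists M; split; [exact: num_real|move=> x Mx w _; exact: le_trans (fM w) (ltW Mx)].
Qed.

Lemma bmfun_cst c : bmfun (fun=> c).
Proof. by split=> //; exists `|c|. Qed.

Lemma bmfunD f g : bmfun f -> bmfun g -> bmfun (fun w => f w + g w).
Proof.
move=> [mf [M fM]] [mg [N gN]]; split; first exact: measurable_funD.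
exists (M + N) => w; apply: (le_trans (ler_normD _ _)); exact: lerD.
Qed.

Lemma bmfunM f g : bmfun f -> bmfun g -> bmfun (fun w => f w * g w).
Proof.
move=> [mf [M fM]] [mg [N gN]]; split; first exact: measurable_funM.
by exists (M * N) => w; rewrite normrM ler_pM.
Qed.

Lemma bmfunZ c f : bmfun f -> bmfun (fun w => c * f w).
Proof. by move=> ?; apply: bmfunM => //; exact: bmfun_cst. Qed.

Lemma bmfunB f g : bmfun f -> bmfun g -> bmfun (fun w => f w - g w).
Proof.
move=> [mf [M fM]] [mg [N gN]]; split; first exact: measurable_funB.
exists (M + N) => w; apply: (le_trans (ler_normB _ _)); exact: lerD.
Qed.

Lemma bmfun_indic (A : set T) : measurable A -> bmfun (\1_A : T -> R).
Proof.
move=> mA; split; first exact: measurable_indic.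
by exists 1 => w; rewrite indicE; case: (_ \in _); rewrite ?normr1 ?normr0.
Qed.

Lemma ExD f g : bmfun f -> bmfun g ->
  \int[P]_w (f w + g w) = \int[P]_w f w + \int[P]_w g w.
Proof. by move=> bf bg; rewrite RintegralD//; exact: bmfun_integrable. Qed.

Lemma ExB f g : bmfun f -> bmfun g ->
  \int[P]_w (f w - g w) = \int[P]_w f w - \int[P]_w g w.
Proof. by move=> bf bg; rewrite RintegralB//; exact: bmfun_integrable. Qed.

Lemma ExZ c f : bmfun f -> \int[P]_w (c * f w) = c * \int[P]_w f w.
Proof. by move=> bf; rewrite RintegralZl//; exact: bmfun_integrable. Qed.

Lemma Ex_cst c : \int[P]_w (fun=> c) w = c.
Proof. rewrite Rintegral_cst// [X in fine X](_ : _ = 1%E) ?mulr1//.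
exact: probability_setT. Qed.

Lemma Ex_le f g : bmfun f -> bmfun g -> (forall w, f w <= g w) ->
  \int[P]_w f w <= \int[P]_w g w.
Proof. by move=> bf bg fg; apply: le_Rintegral => //; exact: bmfun_integrable. Qed.

Lemma Ex_indic (A : set T) : measurable A -> \int[P]_w (\1_A w : R) = fine (P A).
Proof. by move=> mA; rewrite /Rintegral integral_indic// setIT. Qed.

Lemma EFin_Ex f : bmfun f -> (\int[P]_w f w)%:E = (\int[P]_w (f w)%:E)%E.
Proof.
by move=> bf; rewrite fineK//; apply: integrable_fin_num => //; exact: bmfun_integrable.
Qed.

Lemma Ex_dominated_cvg (f_ : nat -> T -> R) f M :
  (forall n, measurable_fun setT (f_ n)) -> measurable_fun setT f ->
  (forall n w, `|f_ n w| <= M) ->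
  {ae P, forall w, f_ n w @[n --> \oo] --> f w} ->
  \int[P]_w f_ n w @[n --> \oo] --> \int[P]_w f w.
Proof.
move=> mf_ mf f_M f_f.
have [|||||intf _ h] := @dominated_convergence _ T R P setT measurableT
  (fun n => EFin \o f_ n) (EFin \o f) (cst M%:E).
- by move=> n; exact/measurable_EFinP.
- exact/measurable_EFinP.
- by apply: filterS f_f => w fw _; apply/fine_cvgP; split => //; exact: nearW.
- by apply: (bmfun_integrable (f := cst M)); exact: bmfun_cst.
- by apply: nearW => w n _ /=; rewrite lee_fin f_M.
apply: fine_cvg; rewrite fineK//.
exact: integrable_fin_num.
Qed.

End BoundedExpectation.

Section DiscreteMeasurability.
Context {R : realType} {d : measure_display} {T : measurableType d}.
Context {S : countType}.
Implicit Types (f : T -> S).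

(** Lists of labels and offspring codes form countable types; for them measurable fibres suffice,
    and no sigma-algebra has to be put on these types. *)
Definition dmeas f := forall s, measurable (f @^-1` [set s]).

Lemma dmeas_preimage f (A : set S) : dmeas f -> measurable (f @^-1` A).
Proof.
move=> mf.
rewrite (_ : _ @^-1` _ = \bigcup_(s in A) f @^-1` [set s]); last first.
  apply/seteqP; split=> [w Aw|w [s As /= fws]]; first by exists (f w).
  by rewrite fws.
rewrite bigcup_mkcond; apply: countable_bigcupT_measurable => // s.
by case: ifP.
Qed.

Lemma dmeas_comp f (g : S -> R) : dmeas f -> measurable_fun setT (g \o f).
Proof.
move=> mf _ A mA; rewrite setTI comp_preimage; exact: dmeas_preimage.
Qed.

Lemma dmeas_map (S' : countType) f (g : S -> S') s : dmeas f -> measurable ((g \o f) @^-1` [set s]).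
Proof. by move=> mf; rewrite comp_preimage; exact: dmeas_preimage. Qed.

Lemma integral_fibers (P : {measure set T -> \bar R}) f (g : T -> \bar R) :
  dmeas f -> measurable_fun setT g -> (forall w, 0 <= g w)%E ->
  (\int[P]_w g w = \sum_(n <oo) \int[P]_(w in [set w | pickle (f w) = n]) g w)%E.
Proof.
move=> mf mg g0.
have mA n : measurable [set w | pickle (f w) = n].
  exact: (dmeas_preimage [set s | pickle s = n] mf).
rewrite -ge0_integral_bigcup//.
- by congr integral; apply/seteqP; split=> // w _; exists (pickle (f w)).
- exact: measurable_funS mg.
- by apply/trivIsetP => i j _ _ /eqP ij; apply/seteqP; split=> // w [/= wi wj]; case: ij; rewrite -wi -wj.
Qed.

(** Stands in for conditioning on a discrete variable: on a fibre the past is constant, so each side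
    can be computed there. *)
Lemma eq_integral_fibers (P : {measure set T -> \bar R}) f (g1 g2 : T -> \bar R) :
  dmeas f -> measurable_fun setT g1 -> measurable_fun setT g2 ->
  (forall w, 0 <= g1 w)%E -> (forall w, 0 <= g2 w)%E ->
  (forall s, \int[P]_(w in f @^-1` [set s]) g1 w =
             \int[P]_(w in f @^-1` [set s]) g2 w)%E ->
  (\int[P]_w g1 w = \int[P]_w g2 w)%E.
Proof.
move=> mf m1 m2 g10 g20 g12; rewrite !(integral_fibers _ mf)//.
apply: eq_eseriesr => n _.
have [[s sn]|no] := pselect (exists s : S, pickle s = n).
  rewrite (_ : [set w | _] = f @^-1` [set s])//.
  apply/seteqP; split=> w /=; rewrite -sn; last by move=> ->.
  exact: (pcan_inj (@pickleK S)).
rewrite (_ : [set w | _] = set0) ?integral_set0//.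
by apply/seteqP; split=> // w /= fw; apply: no; exists (f w).
Qed.

End DiscreteMeasurability.

(** * Trees and offspring *)

Lemma immortal_subSE K off u :
  immortal (K%:Z - 1) off u =
  if (K <= type_of u)%N then (fun l => (l == type_of u) : nat) else off u.
Proof. by rewrite /immortal; congr (if _ then _ else _); apply/idP/idP; lia. Qed.

Definition depth (u : label) := size u.2.

Definition parent (u : label) : label := (u.1, take (depth u).-1 u.2).

Lemma mem_children off u c : c \in children off u ->
  [/\ depth c = (depth u).+1, parent c = u & (type_of c <= (type_of u).+1)%N].
Proof.
case/allpairsPdep => l [j [lu _ ->]]; split.
- by rewrite /depth size_rcons.
- rewrite /parent /depth/= size_rcons /= -cats1 take_size_cat//.
  by case: u {lu}.
- by rewrite /type_of/= /unzip1 map_rcons last_rcons/=; move: lu; rewrite mem_iota.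
Qed.

Lemma children_uniq off u : uniq (children off u).
Proof.
apply: allpairs_uniq_dep.
- exact: iota_uniq.
- by move=> l _; exact: iota_uniq.
- move=> [l j] [l' j'] _ _ /= [/rcons_inj[-> ->]] //.
Qed.

Lemma generationS off i n : generation off i n.+1 =
  flatten [seq children off u | u <- generation off i n].
Proof. by []. Qed.

Lemma generation_depth off i n u : u \in generation off i n -> depth u = n.
Proof.
elim: n u => [u|n IH u]; first by rewrite inE => /eqP ->.
by rewrite generationS => /flatten_mapP[v /IH vn /mem_children[-> _ _]]; rewrite vn.
Qed.

Lemma filter_parent_flatten (ch : label -> seq label) (L : seq label) u :
  (forall v c, c \in ch v -> parent c = v) -> uniq L -> u \in L ->
  [seq c <- flatten (map ch L) | parent c == u] = ch u.
Proof.
move=> chP; elim: L => //= v L IH /andP[vL uL].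
have F x : [seq c <- ch x | parent c == u] = if x == u then ch u else [::].
  case: eqP => [->|xu].
    by apply/all_filterP/allP => c /chP ->.
  apply/eqP; rewrite -size_eq0 size_filter -leqn0 leqNgt -has_count.
  by apply/hasP => -[c /chP -> /eqP].
rewrite inE filter_cat F => /predU1P[uv|uL'].
  rewrite uv eqxx; set s := seq.filter _ _; suff -> : s = [::] by rewrite cats0.
  apply/eqP; rewrite -size_eq0 size_filter -leqn0 leqNgt -has_count.
  apply/hasP => -[c /flatten_mapP[x xL /chP ->] /eqP xv].
  by move: vL; rewrite -xv xL.
rewrite IH//; case: eqP => // vu.
by move: vL; rewrite vu uL'.
Qed.

Lemma generation_uniq off i n : uniq (generation off i n).
Proof.
elim: n => // n IH; rewrite generationS.
elim: (generation off i n) IH => //= u us IH /andP[uus /IH uf].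
rewrite cat_uniq children_uniq uf andbT/=; apply/hasPn => c /flatten_mapP[v vus].
move=> /mem_children[_ cv _]; apply/negP => /mem_children[_ cu _].
by move: uus; rewrite -cu cv vus.
Qed.

(* Given generation n, the event that L is the next generation prescribes the
   children of each individual separately, hence it is a product event. *)
Lemma flatten_childrenP (ch : label -> seq label) (L' L : seq label) :
  (forall v c, c \in ch v -> parent c = v) -> uniq L' ->
  flatten (map ch L') = L <->
  flatten [seq [seq c <- L | parent c == u] | u <- L'] = L /\
  (forall u, u \in L' -> ch u = [seq c <- L | parent c == u]).
Proof.
move=> chP uL'; split=> [<-|[LL chL]].
  have E u : u \in L' -> ch u = [seq c <- flatten (map ch L') | parent c == u].
    by move=> uL; rewrite filter_parent_flatten.
  by split=> //; congr flatten; apply/esym/eq_in_map.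
by rewrite -[RHS]LL; congr flatten; apply/eq_in_map.
Qed.

(** Functions [nat -> nat] are uncountable, but a member of R_i is determined by its first i+2
    values. Listing them gives a countable code, hence the measurability of every event about
    [X u]. *)
Definition offspring_code (i : nat) (r : nat -> nat) : seq nat := mkseq r i.+2.

Lemma offspring_codeK i r : offspring_set i r -> nth 0%N (offspring_code i r) = r.
Proof.
move=> ir; apply/funext => l; have [li|li] := ltnP l i.+2; first by rewrite nth_mkseq.
by rewrite nth_default ?size_mkseq// ir.
Qed.

Section Offspring.
Context {R : realType} {d : measure_display} {T : measurableType d}.
Context (P : probability T R) (p : nat -> (nat -> nat) -> R).
Context (X : label -> T -> nat -> nat) (X_lhbp : LHBP p P X).

Let XO u w : offspring_set (type_of u) (X u w).
Proof. by have [] := X_lhbp. Qed.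

Lemma offspring_code_dmeas u : dmeas (fun w => offspring_code (type_of u) (X u w)).
Proof.
move=> s; have [su|su] := eqVneq (size s) (type_of u).+2.
  rewrite (_ : _ @^-1` _ = X u @^-1` [set nth 0%N s]); first by have [_ + _ _] := X_lhbp.
  apply/seteqP; split=> w /= => [<-|->]; first by rewrite offspring_codeK.
  by rewrite /offspring_code -su mkseq_nth.
rewrite (_ : _ @^-1` _ = set0)//; apply/seteqP; split=> // w /= ws.
by move: su; rewrite -ws size_mkseq eqxx.
Qed.

Lemma offspring_codeE u (S : Type) (f : (nat -> nat) -> S) :
  f \o X u = (f \o nth 0%N) \o (fun w => offspring_code (type_of u) (X u w)).
Proof. by apply/funext => w /=; rewrite offspring_codeK. Qed.

Lemma offspring_preimage u (A : set (nat -> nat)) : measurable (X u @^-1` A).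
Proof.
rewrite (_ : _ @^-1` _ = (fun w => offspring_code (type_of u) (X u w)) @^-1` [set s | A (nth 0%N s)]).
  exact: dmeas_preimage (offspring_code_dmeas u).
by apply/seteqP; split=> w /=; rewrite offspring_codeK.
Qed.

Lemma offspring_measurable_fun u (f : (nat -> nat) -> R) :
  measurable_fun setT (fun w => f (X u w)).
Proof.
rewrite (_ : (fun w => _) = f \o X u)// offspring_codeE.
exact: dmeas_comp (offspring_code_dmeas u).
Qed.

Lemma offspring_dmeas u (S : countType) (f : (nat -> nat) -> S) : dmeas (fun w => f (X u w)).
Proof. by move=> s; exact: (offspring_preimage u [set r | f r = s]). Qed.

(** Both sides are sums over the values of [X u]: the event [X u = r] has probability p_i(r), and
    values outside R_i do not occur. Sums over R_i become expectations in this way. *)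
Lemma esum_offspring u (f : (nat -> nat) -> R) : (forall r, 0 <= f r) ->
  \esum_(r in offspring_set (type_of u)) (p (type_of u) r * f r)%:E =
  (\int[P]_w (f (X u w))%:E)%E.
Proof.
move=> f0; set i := type_of u.
pose a n := (\int[P]_(w in [set w | pickle (offspring_code i (X u w)) = n]) (f (X u w))%:E)%E.
have a0 n : (0 <= a n)%E by apply: integral_ge0 => w _; rewrite lee_fin.
rewrite (integral_fibers _ (offspring_code_dmeas u)); last 2 first.
  by apply/measurable_EFinP; exact: offspring_measurable_fun.
  by move=> w; rewrite lee_fin.
rewrite nneseries_esumT//.
pose e r := pickle (offspring_code i r).
rewrite [RHS](_ : _ = \esum_(n in e @` offspring_set i) a n); last first.
  rewrite [RHS]esum_mkcond; apply: eq_esum => n _; case: ifPn => // /negP nI.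
  rewrite (_ : [set w | _] = set0) ?integral_set0//.
  apply/seteqP; split=> // w /= wn; apply: nI; rewrite inE; exists (X u w) => //.
  exact: XO.
rewrite (reindex_esum (offspring_set i) _ e); last first.
  split.
  - by move=> r ir; exists r.
  - move=> r1 r2; rewrite !inE => /offspring_codeK r1K /offspring_codeK r2K.
    by move=> /(pcan_inj (@pickleK _)) E; rewrite -r1K -r2K E.
  - by [].
apply: eq_esum => r ir; rewrite /a.
rewrite (_ : [set w | _] = X u @^-1` [set r]); last first.
  apply/seteqP; split=> w /= => [/(pcan_inj (@pickleK _)) E|->//].
  by rewrite -(offspring_codeK (XO w)) -(offspring_codeK ir) /= E.
rewrite (eq_integral (cst (f r)%:E)); last by move=> w; rewrite inE => /= ->.
rewrite integral_cst; last exact: offspring_preimage.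
have [_ _ XP _] := X_lhbp.
by rewrite /= XP// -EFinM mulrC.
Qed.

End Offspring.

(** * Independence of the past and the offspring of the present *)

Lemma prob_fibers {R : realType} {d : measure_display} {T : measurableType d}
    (P : probability T R) (S : countType) (f : T -> S) (E F : set T) (c : \bar R) :
  dmeas f -> measurable E -> measurable F -> (0 <= c)%E ->
  (forall s, P (f @^-1` [set s] `&` E) = P (f @^-1` [set s] `&` F) * c)%E ->
  (P E = P F * c)%E.
Proof.
move=> mf mE mF c0 EF.
have H A : measurable A -> (P A = \int[P]_w (\1_A w)%:E)%E.
  by move=> mA; rewrite integral_indic// setIT.
have mi A : measurable A -> measurable_fun setT (EFin \o (\1_A : T -> R)).
  by move=> mA; apply/measurable_EFinP; exact: measurable_indic.
rewrite !H// muleC -ge0_integralZl//; last by exact: mi.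
apply: (eq_integral_fibers mf) => //.
- exact: mi.
- by apply: measurable_funeM; exact: mi.
- by move=> w; rewrite mule_ge0// lee_fin indicE.
move=> s; rewrite ge0_integralZl//; last by apply: (measurable_funS measurableT _ (mi _ mF)).
rewrite !integral_indic//.
by rewrite ![_ `&` (f @^-1` _)]setIC muleC; exact: EF.
Qed.

Section Branching.
Context {R : realType} {d : measure_display} {T : measurableType d}.
Context (P : probability T R) (p : nat -> (nat -> nat) -> R).
Context (X : label -> T -> nat -> nat) (X_lhbp : LHBP p P X).

Let mX u (A : set (nat -> nat)) : measurable (X u @^-1` A).
Proof. exact: offspring_preimage X_lhbp u A. Qed.

Definition cylinder (us : seq label) (A : label -> set (nat -> nat)) : set T :=
  \bigcap_(u in [set` us]) (X u @^-1` A u).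

Lemma cylinder_measurable us A : measurable (cylinder us A).
Proof. by apply: fin_bigcap_measurable => // u _; exact: mX. Qed.

(* E stands for an event about the past, us for the individuals alive. *)
Definition indep_of (E : set T) (us : seq label) : Prop :=
  forall A, (P (E `&` cylinder us A) = P E * \prod_(u <- us) P (X u @^-1` A u))%E.

Lemma cylinder_cat us vs (A B : label -> set (nat -> nat)) : uniq (us ++ vs) ->
  cylinder us A `&` cylinder vs B =
  cylinder (us ++ vs) (fun u => if u \in us then A u else B u).
Proof.
rewrite cat_uniq => /and3P[_ /hasPn uv _].
apply/seteqP; split=> [w [wA wB] u /=|w wAB].
  rewrite mem_cat; case: ifPn => [us_ _|us_ /=]; first exact: wA.
  by move=> uvs; exact: wB.
split=> u /= uin.
  by have /= := wAB u; rewrite mem_cat uin; exact.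
have /= := wAB u; rewrite mem_cat uin orbT => /(_ isT).
by have /= /negbTE -> := uv _ uin.
Qed.

Lemma prod_cylinder_cat us vs (A B : label -> set (nat -> nat)) : uniq (us ++ vs) ->
  (\prod_(u <- us ++ vs) P (X u @^-1` (if u \in us then A u else B u)) =
   \prod_(u <- us) P (X u @^-1` A u) * \prod_(u <- vs) P (X u @^-1` B u))%E.
Proof.
rewrite cat_uniq => /and3P[_ /hasPn uv _]; rewrite big_cat/=; congr (_ * _)%E.
  by rewrite big_seq [RHS]big_seq; apply: eq_bigr => u ->.
by rewrite big_seq [RHS]big_seq; apply: eq_bigr => u /uv /= /negbTE ->.
Qed.

Lemma indep_of_catl E us vs A : uniq (us ++ vs) -> indep_of E (us ++ vs) ->
  (P (E `&` cylinder us A) = P E * \prod_(u <- us) P (X u @^-1` A u))%E.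
Proof.
move=> uv EI; have := EI (fun u => if u \in us then A u else setT).
rewrite prod_cylinder_cat// -cylinder_cat// [X in (_ * (_ * X))%E]big1 ?mule1; last first.
  by move=> u _; rewrite preimage_setT probability_setT.
rewrite (_ : cylinder vs _ = setT) ?setIT// /cylinder; exact/seteqP.
Qed.

Lemma indep_of_cat E us vs A : uniq (us ++ vs) -> indep_of E (us ++ vs) ->
  indep_of (E `&` cylinder us A) vs.
Proof.
move=> uv EI B; rewrite -setIA cylinder_cat// EI prod_cylinder_cat// muleA.
by rewrite (indep_of_catl A uv EI).
Qed.

(** Induction on [us], splitting over the value of [X u] for the first individual u: on such a fibre
    its factor is constant, and E intersected with the fibre is still independent of the remaining
    individuals. *)
Lemma integral_indep E us (f : label -> (nat -> nat) -> R) :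
  measurable E -> uniq us -> (forall u r, 0 <= f u r) -> indep_of E us ->
  (\int[P]_(w in E) (\prod_(u <- us) f u (X u w))%:E =
   P E * \prod_(u <- us) \int[P]_w (f u (X u w))%:E)%E.
Proof.
move=> + + f0; elim: us E => [E mE _ _|u us IH E mE uus EI].
  rewrite big_nil mule1 (eq_integral (cst 1%E)) ?integral_cst ?mul1e//.
  by move=> w _; rewrite big_nil.
have usu : uniq us by case/andP: uus.
pose F w := (\prod_(v <- us) f v (X v w))%R.
have F0 w : 0 <= F w by apply: prodr_ge0.
have mf v : measurable_fun setT (fun w => f v (X v w)).
  exact: (offspring_measurable_fun X_lhbp v).
have mF : measurable_fun setT F.
  by apply: measurable_prod => v _; exact: mf.
pose c := (P E * \prod_(v <- us) \int[P]_w (f v (X v w))%:E)%E.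
have c0 : (0 <= c)%E.
  by apply: mule_ge0 => //; apply: prode_ge0 => v _; apply: integral_ge0 => w _; rewrite lee_fin.
rewrite big_cons muleCA -/c -ge0_integralZr//; last first.
- by move=> w _; rewrite lee_fin.
- by apply/measurable_EFinP.
rewrite [LHS]integral_mkcond; apply: (eq_integral_fibers (offspring_code_dmeas X_lhbp u)).
- apply: (measurable_restrictT _ mE).1; apply: measurable_funTS.
  by apply/measurable_EFinP; apply: measurable_prod => v _; exact: mf.
- by apply: emeasurable_funM => //; exact/measurable_EFinP.
- by move=> w; rewrite patchE; case: ifP => // _; rewrite lee_fin prodr_ge0.
- by move=> w; rewrite mule_ge0// lee_fin.
move=> s; set A := _ @^-1` _; pose r := nth 0%N s.
have mA : measurable A by exact: (offspring_code_dmeas X_lhbp u).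
have Xr w : A w -> X u w = r.
  move=> /= ws; rewrite -(offspring_codeK (i := type_of u) (r := X u w)) ?ws//.
  by have [] := X_lhbp.
have AE : A = cylinder [:: u] (fun=> [set r | offspring_code (type_of u) r = s]).
  apply/seteqP; split=> [w Aw v/=|w /(_ u)]; last by rewrite /= inE eqxx; exact.
  by rewrite inE => /eqP ->.
rewrite -integral_mkcondr setIC.
transitivity (\int[P]_(w in E `&` A) ((f u r)%:E * (F w)%:E))%E.
  apply: eq_integral => w; rewrite inE => -[_ /Xr Xuw].
  by rewrite big_cons EFinM Xuw.
have mEA : measurable (E `&` A) by exact: measurableI.
rewrite ge0_integralZl//; last first.
- by rewrite lee_fin.
- by move=> w _; rewrite lee_fin.
- by apply/measurable_EFinP; exact: measurable_funTS.
rewrite IH//; last by rewrite AE; exact: (@indep_of_cat E [:: u]).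
have -> : (P (E `&` A) = P E * P A)%E.
  by rewrite {1}AE (@indep_of_catl E [:: u] us)// big_seq1.
rewrite [RHS](eq_integral (fun w => (f u r)%:E * c)%E); last first.
  by move=> w; rewrite inE => /Xr ->.
by rewrite integral_cst// /c -!muleA [(P A * _)%E]muleC !muleA.
Qed.

End Branching.

(** * Generations with immortal types and iterates of the generating function *)

Definition unitvec {R : realType} (v : nat -> R) : Prop := forall l, 0 <= v l <= 1.

Definition offspring_gf {R : realType} (p : nat -> (nat -> nat) -> R) i v : R := fine (pgf p i v).

(* One generation of the process in which the types >= K are immortal. *)
Definition gf_step {R : realType} (p : nat -> (nat -> nat) -> R) (K : nat) (v : nat -> R) : nat -> R :=
  fun i => if (i < K)%N then offspring_gf p i v else v i.

(** [children] reads its offspring function only at u; a constant function therefore exhibits the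
    children of u as a function of [X u] alone. *)
Definition immortal_children (K : nat) (u : label) (r : nat -> nat) : seq label :=
  children (fun=> if (K <= type_of u)%N then (fun l => (l == type_of u) : nat) else r) u.

Lemma prod_immortal_children {R : realType} K u r (v : nat -> R) :
  \prod_(c <- immortal_children K u r) v (type_of c) =
  if (K <= type_of u)%N then v (type_of u) else \prod_(l < (type_of u).+2) v l ^+ r l.
Proof.
have H (r' : nat -> nat) : \prod_(c <- children (fun=> r') u) v (type_of c) =
    \prod_(l < (type_of u).+2) v l ^+ r' l.
  rewrite /children big_allpairs_dep/=.
  rewrite -(big_mkord xpredT (fun l => v l ^+ r' l)) /index_iota subn0.
  apply: eq_bigr => l _; rewrite (eq_bigr (fun=> v l)).
    by rewrite big_const_seq count_predT size_iota iter_mulr_1.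
  by move=> j _; rewrite /type_of/= /unzip1 map_rcons last_rcons.
rewrite /immortal_children; case: ifP => _; rewrite H//.
rewrite (bigD1 (Ordinal (ltnW (ltnSn (type_of u).+1))))//= eqxx expr1 big1 ?mulr1// => l.
by move=> /negbTE; rewrite -val_eqE/= => ->; rewrite expr0.
Qed.

Section Generations.
Context {R : realType} {d : measure_display} {T : measurableType d}.
Context (P : probability T R) (p : nat -> (nat -> nat) -> R).
Context (X : label -> T -> nat -> nat) (X_lhbp : LHBP p P X).

Let mX u (A : set (nat -> nat)) : measurable (X u @^-1` A).
Proof. exact: offspring_preimage X_lhbp u A. Qed.

Definition immortal_gen (K i n : nat) (w : T) : seq label :=
  generation (immortal (K%:Z - 1) (X^~ w)) i n.

#[local] Arguments immortal_gen : simpl never.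

Lemma children_immortal K w u :
  children (immortal (K%:Z - 1) (X^~ w)) u = immortal_children K u (X u w).
Proof. by rewrite /immortal_children /children immortal_subSE. Qed.

Lemma immortal_genS K i n w :
  immortal_gen K i n.+1 w = flatten [seq immortal_children K u (X u w) | u <- immortal_gen K i n w].
Proof.
rewrite /immortal_gen generationS; congr flatten; apply: eq_map => u.
exact: children_immortal.
Qed.

Lemma dmeas_mapseq (S : countType) (f : label -> T -> S) us :
  (forall u, dmeas (f u)) -> dmeas (fun w => [seq f u w | u <- us]).
Proof.
move=> mf; elim: us => [|u us IH] s.
  have [->|s0] := eqVneq s [::].
    by rewrite (_ : _ @^-1` _ = setT)//; apply/seteqP; split.
  rewrite (_ : _ @^-1` _ = set0)//; apply/seteqP; split=> //= w E.
  by move: s0; rewrite -E eqxx.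
case: s => [|x s].
  by rewrite (_ : _ @^-1` _ = set0)//; apply/seteqP; split.
rewrite (_ : _ @^-1` _ = (f u @^-1` [set x]) `&`
    ((fun w => [seq f u w | u <- us]) @^-1` [set s])); last first.
  by apply/seteqP; split=> w /= => [[-> ->]|[-> ->]].
by apply: measurableI; [exact: mf|exact: IH].
Qed.

Lemma children_list_dmeas K us : dmeas (fun w => flatten [seq immortal_children K u (X u w) | u <- us]).
Proof.
move=> s; apply: (dmeas_map (f := fun w => [seq immortal_children K u (X u w) | u <- us]) flatten).
apply: dmeas_mapseq => u; exact: (offspring_dmeas X_lhbp u).
Qed.

Lemma immortal_gen_dmeas K i n : dmeas (immortal_gen K i n).
Proof.
elim: n => [|n IH] s.
  have [<-|s0] := eqVneq [:: (i, [::])] s.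
    by rewrite (_ : _ @^-1` _ = setT)//; apply/seteqP; split.
  rewrite (_ : _ @^-1` _ = set0)//; apply/seteqP; split=> //= w E.
  by move: s0; rewrite -E eqxx.
rewrite (_ : _ @^-1` _ = \bigcup_L ((immortal_gen K i n @^-1` [set L]) `&`
   ((fun w => flatten [seq immortal_children K u (X u w) | u <- L]) @^-1` [set s]))); last first.
  apply/seteqP; split=> [w /= E|w [L _ [/= EL Es]]].
    by exists (immortal_gen K i n w) => //=; rewrite -immortal_genS.
  by rewrite /= immortal_genS EL.
apply: countable_bigcupT_measurable => [|L]; first exact: countableP.
by apply: measurableI; [exact: IH|exact: children_list_dmeas].
Qed.

(** If generation n is L', generation n.+1 is decided by the offspring of the members of L', all of
    depth n, whereas [us] has depth at least n.+1. The two lists are disjoint, so the induction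
    hypothesis applies to [L' ++ us]. *)
Lemma immortal_gen_indep K i n L us : uniq us -> (forall u, u \in us -> (n <= depth u)%N) ->
  indep_of P X (immortal_gen K i n @^-1` [set L]) us.
Proof.
elim: n L us => [|n IH] L us uus dus A.
  have [_ _ _ XI] := X_lhbp.
  have [<-|s0] := eqVneq [:: (i, [::])] L.
    rewrite (_ : _ @^-1` _ = setT); last by apply/seteqP; split.
    by rewrite setTI XI// probability_setT mul1e.
  rewrite (_ : _ @^-1` _ = set0); first by rewrite set0I measure0 mul0e.
  by apply/seteqP; split=> //= w E; move: s0; rewrite -E eqxx.
apply: (prob_fibers (immortal_gen_dmeas K i n)).
- by apply: measurableI; [exact: immortal_gen_dmeas|exact: cylinder_measurable X_lhbp _ _].
- exact: immortal_gen_dmeas.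
- exact: prode_ge0.
move=> L'.
(* A list L' that cannot precede L gives an empty fibre on both sides. *)
have [[uL' dL' LL]|noL] := pselect [/\ uniq L', forall u, u \in L' -> depth u = n
    & flatten [seq [seq c <- L | parent c == u] | u <- L'] = L]; last first.
  have N w : immortal_gen K i n w = L' -> immortal_gen K i n.+1 w = L -> False.
    move=> EL' EL; apply: noL; rewrite -EL'; split.
    - exact: generation_uniq.
    - by move=> u; exact: generation_depth.
    have [H _] := flatten_childrenP (ch := fun u => immortal_children K u (X u w)) L
      (fun v c cv => let: And3 _ cP _ := mem_children cv in cP)
      (generation_uniq (immortal (K%:Z - 1) (X^~ w)) i n).
    by have [] := H (etrans (esym (immortal_genS K i n w)) EL).
  rewrite setIA (_ : immortal_gen K i n @^-1` _ `&` immortal_gen K i n.+1 @^-1` _ = set0).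
    by rewrite set0I measure0 mul0e.
  by apply/seteqP; split=> // w [/= /N].
pose B u := [set r | immortal_children K u r = [seq c <- L | parent c == u]].
have EB : immortal_gen K i n @^-1` [set L'] `&` immortal_gen K i n.+1 @^-1` [set L] =
          immortal_gen K i n @^-1` [set L'] `&` cylinder X L' B.
  have H w := flatten_childrenP (ch := fun u => immortal_children K u (X u w)) L
      (fun v c cv => let: And3 _ cP _ := mem_children cv in cP) uL'.
  apply/seteqP; split=> w [/= EL' EL]; split=> //.
    move: EL; rewrite immortal_genS EL' => /H[_ {}H u /= uL]; exact: H.
  by rewrite /= immortal_genS EL'; apply/H.
have uL's : uniq (L' ++ us).
  rewrite cat_uniq uL' uus andbT; apply/hasPn => u /dus /= du.
  by apply/negP => /dL' dn; move: du; rewrite dn ltnn.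
have I : indep_of P X (immortal_gen K i n @^-1` [set L']) (L' ++ us).
  apply: IH => // u; rewrite mem_cat => /orP[/dL' ->//|/dus]; exact: ltnW.
by rewrite setIA EB; exact: (indep_of_cat B uL's I A).
Qed.

Lemma pgf_integral u (v : nat -> R) : unitvec v ->
  pgf p (type_of u) v = (\int[P]_w (\prod_(k < (type_of u).+2) v k ^+ X u w k)%:E)%E.
Proof.
move=> v01; rewrite /pgf (esum_offspring X_lhbp u
  (f := fun r => \prod_(k < (type_of u).+2) v k ^+ r k))// => r.
by apply: prodr_ge0 => k _; apply: exprn_ge0; have /andP[] := v01 k.
Qed.

Lemma monom_unit u (r : nat -> nat) (v : nat -> R) : unitvec v ->
  0 <= \prod_(k < (type_of u).+2) v k ^+ r k <= 1.
Proof.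
move=> v01; apply/andP; split.
  by apply: prodr_ge0 => k _; apply: exprn_ge0; have /andP[] := v01 k.
by apply: prodr_ile1 => k _; have /andP[v0 v1] := v01 k; rewrite exprn_ge0//= exprn_ile1.
Qed.

Lemma bmfun_offspring u (f : (nat -> nat) -> R) M :
  (forall r, `|f r| <= M) -> bmfun (fun w => f (X u w)).
Proof.
move=> fM; split; first exact: offspring_measurable_fun X_lhbp u f.
by exists M => w.
Qed.

Lemma bmfun_monom u (v : nat -> R) : unitvec v ->
  bmfun (fun w => \prod_(k < (type_of u).+2) v k ^+ X u w k).
Proof.
move=> v01; apply: (bmfun_offspring u (f := fun r => \prod_(k < _) v k ^+ r k) (M := 1)) => r.
by have /andP[? ?] := monom_unit u r v01; rewrite ger0_norm.
Qed.

Lemma offspring_gf_Ex i (v : nat -> R) : unitvec v ->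
  offspring_gf p i v = \int[P]_w (\prod_(k < i.+2) v k ^+ X (i, [::]) w k).
Proof. by move=> v01; rewrite /offspring_gf (pgf_integral (i, [::])). Qed.

Lemma offspring_gf_EFin i (v : nat -> R) : unitvec v -> (offspring_gf p i v)%:E = pgf p i v.
Proof.
move=> v01; rewrite offspring_gf_Ex// EFin_Ex; last exact: (bmfun_monom (i, [::])).
by rewrite (pgf_integral (i, [::])).
Qed.

Lemma offspring_gf_unit i (v : nat -> R) : unitvec v -> 0 <= offspring_gf p i v <= 1.
Proof.
move=> v01; rewrite offspring_gf_Ex//; have bm := bmfun_monom (i, [::]) v01.
have m01 w := monom_unit (i, [::]) (X (i, [::]) w) v01.
apply/andP; split; first by apply: Rintegral_ge0 => w _; have /andP[] := m01 w.
rewrite -[leRHS](Ex_cst P); apply: Ex_le => //; first exact: bmfun_cst.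
by move=> w; have /andP[] := m01 w.
Qed.

Lemma gf_step_unit K (v : nat -> R) : unitvec v -> unitvec (gf_step p K v).
Proof. by move=> v01 l; rewrite /gf_step; case: ifP => // _; exact: offspring_gf_unit. Qed.

Lemma iter_gf_step_unit K n (v : nat -> R) : unitvec v -> unitvec (iter n (gf_step p K) v).
Proof. by move=> v01; elim: n => //= n; exact: gf_step_unit. Qed.

Lemma prod_unit (I : Type) (s : seq I) (f : I -> R) : (forall i, 0 <= f i <= 1) ->
  0 <= \prod_(i <- s) f i <= 1.
Proof.
move=> f01; apply/andP; split; first by apply: prodr_ge0 => i _; have /andP[] := f01 i.
by apply: prodr_ile1 => i _; exact: f01.
Qed.

Lemma immortal_gen_comp_meas K i n (f : seq label -> R) : measurable_fun setT (fun w => f (immortal_gen K i n w)).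
Proof. exact: (dmeas_comp f (immortal_gen_dmeas K i n)). Qed.

Lemma prod_immortal_genS K i n v w :
  \prod_(u <- immortal_gen K i n.+1 w) v (type_of u) =
  \prod_(u <- immortal_gen K i n w) \prod_(c <- immortal_children K u (X u w)) v (type_of c) :> R.
Proof. by rewrite immortal_genS big_flatten big_map. Qed.

(** Branching property: once generation n is fixed, its members reproduce independently, a type i <
    K contributing the factor G_i(v) and an immortal type its own v_i. *)
Lemma integral_prod_immortal_genS K i n (v : nat -> R) : unitvec v ->
  (\int[P]_w (\prod_(u <- immortal_gen K i n.+1 w) v (type_of u))%:E =
   \int[P]_w (\prod_(u <- immortal_gen K i n w) gf_step p K v (type_of u))%:E)%E.
Proof.
move=> v01; have sv01 := gf_step_unit K v01.
have P0 (v' : nat -> R) (s : seq label) : unitvec v' -> (0%:E <= (\prod_(u <- s) v' (type_of u))%:E)%E.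
  by move=> v'01; rewrite lee_fin; have /andP[] := prod_unit s (f := v' \o type_of) (fun u => v'01 (type_of u)).
apply: (eq_integral_fibers (immortal_gen_dmeas K i n)).
- apply/measurable_EFinP.
  exact: (immortal_gen_comp_meas _ _ _ (fun s => \prod_(u <- s) v (type_of u))).
- apply/measurable_EFinP.
  exact: (immortal_gen_comp_meas _ _ _ (fun s => \prod_(u <- s) gf_step p K v (type_of u))).
- by move=> w; exact: P0.
- by move=> w; exact: P0.
move=> L.
pose f u r := \prod_(c <- immortal_children K u r) v (type_of c).
have mE := immortal_gen_dmeas K i n L.
transitivity (\int[P]_(w in immortal_gen K i n @^-1` [set L]) (\prod_(u <- L) f u (X u w))%:E)%E.
  by apply: eq_integral => w; rewrite inE => /= EL; rewrite prod_immortal_genS EL.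
have [[uL dL]|noL] := pselect (uniq L /\ forall u, u \in L -> (n <= depth u)%N); last first.
  rewrite (_ : _ @^-1` _ = set0) ?integral_set0//.
  apply/seteqP; split=> // w /= EL; apply: noL; rewrite -EL; split.
    exact: generation_uniq.
  by move=> u /generation_depth ->.
rewrite (integral_indep X_lhbp) //; last 2 first.
- by move=> u r; have /andP[] := prod_unit (immortal_children K u r) (fun c => v01 (type_of c)).
- exact: immortal_gen_indep.
rewrite [RHS](eq_integral (cst (\prod_(u <- L) gf_step p K v (type_of u))%:E)); last first.
  by move=> w; rewrite inE => /= ->.
rewrite integral_cst// muleC; congr (_ * _)%E.
rewrite -prodEFin; apply: eq_bigr => u _.
rewrite /gf_step; case: ltnP => [uK|Ku].
  rewrite offspring_gf_EFin// (pgf_integral u)//; apply: eq_integral => w _.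
  by rewrite /f prod_immortal_children leqNgt uK.
rewrite (eq_integral (cst (v (type_of u))%:E)).
  by rewrite integral_cst//= probability_setT mule1.
by move=> w _; rewrite /f prod_immortal_children Ku.
Qed.

Lemma Ex_prod_immortal_gen K i n (v : nat -> R) : unitvec v ->
  \int[P]_w (\prod_(u <- immortal_gen K i n w) v (type_of u)) = iter n (gf_step p K) v i.
Proof.
move=> v01; elim: n v v01 => [|n IH] v v01.
  rewrite -[RHS](Ex_cst P); apply: eq_Rintegral => w _.
  by rewrite /immortal_gen/= big_seq1.
by rewrite /Rintegral integral_prod_immortal_genS// iterSr -IH//; exact: gf_step_unit.
Qed.

End Generations.

(** * Generating functions *)

(** If no possible offspring contained type j, lowering s_j would leave G_i unchanged and the
    difference quotient would vanish identically. *)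
Lemma mean_progeny_gt0 {R : realType} (p : nat -> (nat -> nat) -> R) i j :
  offspring_law p -> (0 < mean_progeny p i j)%E ->
  exists r, [/\ offspring_set i r, 0 < p i r, (0 < r j)%N & (j < i.+2)%N].
Proof.
move=> [p0 p1] M0; apply: contrapT => no.
have pgf1 h : pgf p i (fun l => if l == j then 1 - h else 1) = 1%E.
  rewrite -(p1 i); apply: eq_esum => r ir; congr (_%:E).
  have := p0 i r ir; rewrite le_eqVlt => /predU1P[<-|pr0]; first by rewrite mul0r.
  rewrite big1 ?mulr1// => k _; case: eqP => [kj|_]; last by rewrite expr1n.
  have [->|rk] := posnP (r k); first by rewrite expr0.
  by case: no; exists r; split=> //; rewrite -kj.
have pgf11 : pgf p i (fun=> 1) = 1%E.
  rewrite -(pgf1 0); congr pgf; apply/funext => l.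
  by rewrite subr0; case: ifP.
suff : mean_progeny p i j = 0%E by move=> M; move: M0; rewrite M ltxx.
apply: cvg_lim => //; apply: cvg_near_cst; apply: nearW => h.
by rewrite pgf1 pgf11 subee// mul0e.
Qed.

Lemma cvg_prodn {R : realType} (I : Type) (s : seq I) (f_ : nat -> I -> R) (f : I -> R) :
  (forall i, f_ n i @[n --> \oo] --> f i) ->
  \prod_(i <- s) f_ n i @[n --> \oo] --> \prod_(i <- s) f i.
Proof.
move=> f_f; elim: s => [|i s IH].
  by rewrite big_nil; under eq_fun do rewrite big_nil; exact: cvg_cst.
by rewrite big_cons; under eq_fun do rewrite big_cons; exact: cvgM.
Qed.

Section GeneratingFunctions.
Context {R : realType} {d : measure_display} {T : measurableType d}.
Context (P : probability T R) (p : nat -> (nat -> nat) -> R).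
Context (X : label -> T -> nat -> nat) (p_law : offspring_law p) (X_lhbp : LHBP p P X).

Lemma offspring_gf_mono i (v w : nat -> R) : unitvec v -> unitvec w ->
  (forall l, (l < i.+2)%N -> v l <= w l) -> offspring_gf p i v <= offspring_gf p i w.
Proof.
move=> v01 w01 vw; rewrite !(offspring_gf_Ex X_lhbp)//.
apply: Ex_le; [exact: (bmfun_monom X_lhbp (i, [::]))|exact: (bmfun_monom X_lhbp (i, [::]))|].
move=> t; apply: ler_prod => l _; have /andP[v0 _] := v01 l.
by rewrite exprn_ge0//= lerXn2r ?nnegrE ?vw//; have /andP[] := w01 l.
Qed.

Lemma offspring_gf_cvg i (v_ : nat -> nat -> R) (v : nat -> R) :
  (forall n, unitvec (v_ n)) -> unitvec v ->
  (forall l, v_ n l @[n --> \oo] --> v l) ->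
  offspring_gf p i (v_ n) @[n --> \oo] --> offspring_gf p i v.
Proof.
move=> v_01 v01 v_v; under eq_fun do rewrite (offspring_gf_Ex X_lhbp)//.
rewrite (offspring_gf_Ex X_lhbp)//; apply: (Ex_dominated_cvg (M := 1)).
- by move=> n; have [] := bmfun_monom X_lhbp (i, [::]) (v_01 n).
- by have [] := bmfun_monom X_lhbp (i, [::]) v01.
- move=> n w; have /andP[m0 m1] := monom_unit (i, [::]) (X (i, [::]) w) (v_01 n).
  by rewrite ger0_norm.
apply: nearW => w.
apply: cvg_prodn => l.
apply: (@cvg_comp _ _ _ (fun n => v_ n l) (fun x => x ^+ X (i, [::]) w l)).
  exact: v_v.
exact: exprn_continuous.
Qed.

(** On the segment from u to the vector 1, each monomial is a product of nonnegative, nondecreasing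
    affine functions of x, hence convex, with value 1 at x = 1. *)
Lemma offspring_gf_convex i (u : nat -> R) x : unitvec u -> 0 <= x <= 1 ->
  offspring_gf p i (fun l => (1 - x) * u l + x) <= (1 - x) * offspring_gf p i u + x.
Proof.
move=> u01 /andP[x0 x1].
have ux01 : unitvec (fun l => (1 - x) * u l + x).
  by move=> l; have := u01 l; nra.
rewrite !(offspring_gf_Ex X_lhbp)//.
have bu := bmfun_monom X_lhbp (i, [::]) u01.
have bux := bmfun_monom X_lhbp (i, [::]) ux01.
have <- : \int[P]_w ((1 - x) * (\prod_(k < i.+2) u k ^+ X (i, [::]) w k) + x) =
    (1 - x) * \int[P]_w (\prod_(k < i.+2) u k ^+ X (i, [::]) w k) + x.
  rewrite ExD ?ExZ ?(Ex_cst P)//; first exact: bmfunZ.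
  exact: bmfun_cst.
apply: Ex_le => //; first by apply: bmfunD; [exact: bmfunZ|exact: bmfun_cst].
move=> w; set r := X _ w.
(* Chord bounds are stable under products: the chord of [a * b] exceeds the product of the two
   chords by exactly [x * (1 - x) * ((1 - a) * (1 - b))]. *)
have E a b : 0 <= a <= 1 -> 0 <= b <= 1 -> forall a' b', 0 <= a' -> 0 <= b' ->
   a' <= (1 - x) * a + x -> b' <= (1 - x) * b + x -> a' * b' <= (1 - x) * (a * b) + x.
  move=> /andP[a0 a1] /andP[b0 b1] a' b' a'0 b'0 ha hb.
  have : a' * b' <= ((1 - x) * a + x) * ((1 - x) * b + x) by rewrite ler_pM.
  have : 0 <= x * (1 - x) * ((1 - a) * (1 - b)).
    by apply: mulr_ge0; apply: mulr_ge0; lra.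
  nra.
have Ex n a : 0 <= a <= 1 -> ((1 - x) * a + x) ^+ n <= (1 - x) * a ^+ n + x.
  move=> a01; elim: n => [|n IH]; first by rewrite !expr0; lra.
  rewrite !exprS; apply: E => //.
  - by have /andP[? ?] := a01; rewrite exprn_ge0// exprn_ile1.
  - by nra.
  - by apply: exprn_ge0; nra.
suff [] : [/\ \prod_(k < i.+2) ((1 - x) * u k + x) ^+ r k <=
    (1 - x) * \prod_(k < i.+2) u k ^+ r k + x,
    0 <= \prod_(k < i.+2) ((1 - x) * u k + x) ^+ r k &
    0 <= \prod_(k < i.+2) u k ^+ r k <= 1] by [].
apply: (big_ind2 (fun a b => [/\ a <= (1 - x) * b + x, 0 <= a & 0 <= b <= 1])).
- by split; lra.
- move=> a1 b1 a2 b2 [h1 a10 b10] [h2 a20 b20]; split; last 2 first.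
  + exact: mulr_ge0.
  + have /andP[? ?] := b10; have /andP[? ?] := b20.
    by rewrite mulr_ge0//= mulr_ile1.
  exact: E.
move=> k _; have u01k := u01 k; have /andP[uk0 uk1] := u01k; split.
- exact: Ex.
- by apply: exprn_ge0; nra.
- by rewrite exprn_ge0//= exprn_ile1.
Qed.

Lemma offspring_gf_lt1 i j (v : nat -> R) : unitvec v -> (0 < mean_progeny p i j)%E ->
  v j < 1 -> offspring_gf p i v < 1.
Proof.
move=> v01 M vj; have [r [ir pr rj ji]] := mean_progeny_gt0 p_law M.
pose mon (r' : nat -> nat) := \prod_(k < i.+2) v k ^+ r' k.
have mon01 r' : 0 <= mon r' <= 1 by exact: (monom_unit (i, [::]) r' v01).
have c0 : 0 < 1 - mon r.
  rewrite subr_gt0 /mon (bigD1 (Ordinal ji))//=.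
  apply: (@le_lt_trans _ _ (v j ^+ r j)).
    rewrite ler_piMr//; first by apply: exprn_ge0; have /andP[] := v01 j.
    apply: prodr_ile1 => k _; have /andP[? ?] := v01 k.
    by rewrite exprn_ge0//= exprn_ile1.
  by have /andP[vj0 _] := v01 j; rewrite exprn_ilt1 -?lt0n.
have mA : measurable (X (i, [::]) @^-1` [set r]) by exact: (offspring_preimage X_lhbp).
have [_ _ XP _] := X_lhbp.
rewrite (offspring_gf_Ex X_lhbp)//.
apply: (@le_lt_trans _ _ (\int[P]_w (1 - (1 - mon r) * \1_(X (i, [::]) @^-1` [set r]) w))).
  apply: Ex_le.
  - exact: (bmfun_monom X_lhbp (i, [::])).
  - by apply: bmfunB; [exact: bmfun_cst|exact: (bmfunZ _ (bmfun_indic mA))].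
  move=> w; rewrite indicE; have [|_] := boolP (w \in _).
    by rewrite inE => /= ->; rewrite mulr1 subKr.
  by rewrite mulr0 subr0; have /andP[] := mon01 (X (i, [::]) w).
rewrite ExB; last 2 first.
- exact: bmfun_cst.
- by exact: (bmfunZ _ (bmfun_indic mA)).
rewrite Ex_cst ExZ; last exact: (bmfun_indic mA).
rewrite Ex_indic// (XP (i, [::]))//= ltrBlDr ltrDl mulr_gt0//.
Qed.

Lemma iter_gf_step_ge K n (v : nat -> R) l : (K <= l)%N -> iter n (gf_step p K) v l = v l.
Proof. by move=> Kl; elim: n => //= n <-; rewrite /gf_step ltnNge Kl. Qed.

Lemma iter_gf_step_mono K n (v w : nat -> R) : unitvec v -> unitvec w ->
  (forall l, (l <= K)%N -> v l <= w l) ->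
  forall l, (l <= K)%N -> iter n (gf_step p K) v l <= iter n (gf_step p K) w l.
Proof.
move=> v01 w01 vw; elim: n => [//|n IH] l lK /=; rewrite /gf_step.
case: ifP => [lK'|_]; last exact: IH.
apply: offspring_gf_mono.
- exact: (iter_gf_step_unit X_lhbp).
- exact: (iter_gf_step_unit X_lhbp).
- by move=> m ml; apply: IH; lia.
Qed.

Lemma le_iter_gf_step K n (v w : nat -> R) : unitvec v -> unitvec w ->
  (forall l, (l < K)%N -> v l <= offspring_gf p l v) ->
  (forall l, (l <= K)%N -> v l <= w l) ->
  forall l, (l <= K)%N -> v l <= iter n (gf_step p K) w l.
Proof.
move=> v01 w01 vG vw; elim: n => [//|n IH] l lK /=; rewrite /gf_step.
case: ifP => [lK'|_]; last exact: IH.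
apply: (le_trans (vG _ lK')); apply: offspring_gf_mono => //.
  exact: (iter_gf_step_unit X_lhbp).
by move=> m ml; apply: IH; lia.
Qed.

Lemma iter_gf_step_le K n (v w : nat -> R) : unitvec v -> unitvec w ->
  (forall l, (l < K)%N -> offspring_gf p l v <= v l) ->
  (forall l, (l <= K)%N -> w l <= v l) ->
  forall l, (l <= K)%N -> iter n (gf_step p K) w l <= v l.
Proof.
move=> v01 w01 vG vw; elim: n => [//|n IH] l lK /=; rewrite /gf_step.
case: ifP => [lK'|_]; last exact: IH.
apply: (le_trans _ (vG _ lK')); apply: offspring_gf_mono => //.
  exact: (iter_gf_step_unit X_lhbp).
by move=> m ml; apply: IH; lia.
Qed.

Definition cutvec (K : nat) (x y : R) : nat -> R := fun l => if (l < K)%N then x else y.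

Lemma cutvec_unit K x y : 0 <= x <= 1 -> 0 <= y <= 1 -> unitvec (cutvec K x y).
Proof. by move=> x01 y01 l; rewrite /cutvec; case: ifP. Qed.

(* For a root of type i <= K and y < 1 this is E_i[y^(Y_K); Y_K < oo]; after n
   steps the exponent only counts the type-K individuals born so far. *)
Definition embedded_gf (K : nat) (y : R) (i : nat) : R :=
  limn (fun n => iter n (gf_step p K) (cutvec K 1 y) i).

Section EmbeddedGf.
Context (K : nat) (y : R) (y01 : 0 <= y <= 1).

Let t01 : unitvec (cutvec K 1 y).
Proof. by apply: cutvec_unit => //; rewrite ler01 lexx. Qed.

Lemma embedded_gf_decr i n : (i <= K)%N ->
  iter n.+1 (gf_step p K) (cutvec K 1 y) i <= iter n (gf_step p K) (cutvec K 1 y) i.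
Proof.
move=> iK; rewrite iterSr; apply: iter_gf_step_mono => //.
  exact: (gf_step_unit X_lhbp).
move=> l lK; rewrite /gf_step; case: ifP => // lK'.
by rewrite {2}/cutvec lK'; have /andP[] := offspring_gf_unit X_lhbp l t01.
Qed.

Lemma embedded_gf_cvg i : iter n (gf_step p K) (cutvec K 1 y) i @[n --> \oo] --> embedded_gf K y i.
Proof.
have [iK|Ki] := leqP i K; last first.
  rewrite /embedded_gf (_ : (fun n => _) = fun=> cutvec K 1 y i); last first.
    by apply/funext => n; rewrite iter_gf_step_ge// ltnW.
  by rewrite lim_cst//; exact: cvg_cst.
apply: nonincreasing_is_cvgn.
  by apply/nonincreasing_seqP => n; exact: embedded_gf_decr.
exists 0 => _ [n _ <-].
by have /andP[] := iter_gf_step_unit X_lhbp K n t01 i.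
Qed.

Lemma embedded_gf_unit : unitvec (embedded_gf K y).
Proof.
move=> i; have h := @embedded_gf_cvg i; have u n := iter_gf_step_unit X_lhbp K n t01 i.
apply/andP; split.
  by rewrite -(cvg_lim (@Rhausdorff R) h); apply: limr_ge; [apply/cvg_ex; eexists; exact: h|apply: nearW => n; have /andP[] := u n].
by rewrite -(cvg_lim (@Rhausdorff R) h); apply: limr_le; [apply/cvg_ex; eexists; exact: h|apply: nearW => n; have /andP[] := u n].
Qed.

Lemma embedded_gf_ge i : (K <= i)%N -> embedded_gf K y i = y.
Proof.
move=> Ki; have := @embedded_gf_cvg i.
rewrite (_ : (fun n => _) = fun=> y); last first.
  by apply/funext => n; rewrite iter_gf_step_ge// /cutvec ltnNge Ki.
by move=> h; exact: (cvg_unique (@Rhausdorff R) h (cvg_cst y)).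
Qed.

Lemma embedded_gf_fix i : (i < K)%N -> embedded_gf K y i = offspring_gf p i (embedded_gf K y).
Proof.
move=> iK; have h := @embedded_gf_cvg i; rewrite -(cvg_shiftS) in h.
apply: (cvg_unique (@Rhausdorff R) h).
rewrite (_ : (fun n => _) = fun n => offspring_gf p i (iter n (gf_step p K) (cutvec K 1 y))); last first.
  by apply/funext => n; rewrite /= {1}/gf_step iK.
apply: offspring_gf_cvg.
- by move=> n; exact: (iter_gf_step_unit X_lhbp).
- exact: embedded_gf_unit.
- exact: embedded_gf_cvg.
Qed.

End EmbeddedGf.

End GeneratingFunctions.

(** * Uniqueness of fixed points *)

Lemma sum_count_eq (I : Type) (f : I -> nat) k (s : seq I) :
  (\sum_(i < k) count (fun u => f u == i) s = count (fun u => f u < k) s)%N.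
Proof.
elim: s => [|u s IH] /=; first by rewrite big1.
rewrite big_split/= IH; congr (_ + _)%N.
have [uk|uk] := ltnP (f u) k.
  rewrite (bigD1 (Ordinal uk))//= eqxx big1// => i.
  by rewrite -val_eqE/= eq_sym => /negbTE ->.
rewrite big1// => i _; apply/eqP; rewrite eqb0; apply/eqP => E.
by move: uk; rewrite E leqNgt ltn_ord.
Qed.

Lemma low_typesE {R : realType} {d} {T : measurableType d} (X : label -> T -> nat -> nat) k n w :
  low_types X k n w = (count (fun u => (type_of u < k.+1)%N) (immortal_gen X k.+1 k n w))%:R%:E :> \bar R.
Proof.
rewrite /low_types -sum_count_eq /Z /immortal_gen.
by rewrite (_ : k.+1%:Z - 1 = k%:Z :> int)//; lia.
Qed.

Section Fixed.
Context {R : realType} {d : measure_display} {T : measurableType d}.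
Context (P : probability T R) (p : nat -> (nat -> nat) -> R).
Context (X : label -> T -> nat -> nat) (p_law : offspring_law p) (X_lhbp : LHBP p P X).
Context (M_up : forall i, (0 < mean_progeny p i i.+1)%E) (X_dich : dichotomy P X).

Let S k n w := count (fun u => (type_of u < k.+1)%N) (immortal_gen X k.+1 k n w).

(** The two events of (D) are disjoint and their probabilities add up to 1; what has to be supplied
    is their measurability. *)
Lemma low_types_ae k : {ae P, forall w,
  low_types X k n w @[n --> \oo] --> (0%E : \bar R) \/ low_types X k n w @[n --> \oo] --> (+oo%E : \bar R)}.
Proof.
have m n : measurable_fun setT (low_types X k n : T -> \bar R).
  rewrite (_ : low_types X k n = fun w => (S k n w)%:R%:E); last first.
    by apply/funext => w; exact: low_typesE.
  apply/measurable_EFinP.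
  exact: (immortal_gen_comp_meas X_lhbp k.+1 k n (fun s => (count (fun u => (type_of u < k.+1)%N) s)%:R)).
have l0 n w : (0 <= low_types X k n w :> \bar R)%E by rewrite low_typesE lee_fin.
have cvgS (u : nat -> T -> \bar R) l : (forall n, measurable_fun setT (u n)) ->
    (forall n w, l <= u n w)%E -> measurable [set w | u n w @[n --> \oo] --> l].
  move=> mu lu.
  rewrite (_ : [set w | _] = setT `&` (fun w => limn_esup (u ^~ w)) @^-1` [set l]).
    by apply: (measurable_fun_limn_esup mu) => //; exact: emeasurable_set1.
  rewrite setTI; apply/seteqP; split=> w /= => [uw|supw].
    exact: (cvg_limn_einf_sup uw).2.
  by apply: limn_esup_le_cvg => //; rewrite supw.
set A := [set w | low_types X k n w @[n --> \oo] --> (0%E : \bar R)].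
set B := [set w | low_types X k n w @[n --> \oo] --> (+oo%E : \bar R)].
have mA : measurable A by exact: cvgS.
have mB : measurable B.
  (* [cvgS] requires the limit to be a lower bound of the sequence, so divergence to +oo is restated
     for the opposite sequence. *)
  rewrite (_ : B = [set w | (- low_types X k n w)%E @[n --> \oo] --> (-oo%E : \bar R)]).
    apply: cvgS => [n|n w]; last exact: leNye.
    by apply: measurableT_comp.
  apply/seteqP; split=> w /= uw; first exact: (cvgeN uw).
  apply: cvg_trans (cvgeN uw); apply: near_eq_cvg; apply: nearW => n.
  by rewrite /= opprK.
have AB0 : A `&` B = set0.
  rewrite -subset0 => w [/= wA wB].
  have E : (0%E : \bar R) = +oo%E by exact: (cvg_unique (@ereal_hausdorff R) wA wB).
  discriminate E.
have PAB0 : (P A + P B = 1)%E := X_dich k.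
have PAB : P (A `|` B) = 1%E by exact: etrans (measureU P mA mB AB0) PAB0.
exists (~` (A `|` B)); split.
- by apply: measurableC; exact: measurableU.
- by rewrite probability_setC ?PAB ?subee//; exact: measurableU.
- by move=> w; apply: contra_not.
Qed.

Lemma cvgn_nat_eq0 (u : nat -> nat) (l : \bar R) : l = 0%E ->
  (u n)%:R%:E @[n --> \oo] --> l -> \forall n \near \oo, u n = 0%N.
Proof.
move=> -> /fine_cvgP[_ /cvgr_dist_lt /(_ 1 ltr01) h].
apply: filterS h => n /=.
by rewrite sub0r normrN normr_nat ltrn1 ltnS leqn0 => /eqP.
Qed.

(** Each alternative of (D) kills the integrand: either S is eventually 0, or S tends to infinity
    and x ^+ S tends to 0. *)
Lemma dichotomy_cvg k x : 0 <= x < 1 ->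
  \int[P]_w (x ^+ S k n w - (S k n w == 0)%:R) @[n --> \oo] --> (0 : R).
Proof.
move=> /andP[x0 x1]; rewrite -[X in _ --> X](Ex_cst P).
apply: (Ex_dominated_cvg (M := 1)) => //.
- move=> n; exact: (immortal_gen_comp_meas X_lhbp k.+1 k n (fun s =>
   let c := count (fun u => (type_of u < k.+1)%N) s in x ^+ c - (c == 0)%:R)).
- move=> n w; case: eqP => [->|_]; first by rewrite expr0 subrr normr0.
  by rewrite subr0 ger0_norm ?exprn_ge0// exprn_ile1// ltW.
apply: filterS (low_types_ae k) => w [] /=; under eq_fun do rewrite low_typesE -/(S k _ w).
  move=> /(cvgn_nat_eq0 erefl) S0; apply: cvg_near_cst.
  by apply: filterS S0 => n ->; rewrite expr0 subrr.
move=> Soo.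
have S_gt m : \forall n \near \oo, (m <= S k n w)%N.
  move/cvgeyPge : Soo => /(_ m%:R); apply: filterS => n.
  by rewrite lee_fin ler_nat.
have Snat : S k n w @[n --> \oo] --> \oo.
  by apply/cvgnyPge => m; exact: S_gt.
have nx : `|x| < 1 by rewrite ger0_norm.
have h : x ^+ S k n w @[n --> \oo] --> (0 : R).
  apply: (@cvg_comp _ _ _ (fun n => S k n w) (GRing.exp x)); first exact: Snat.
  exact: cvg_expr.
apply: cvg_trans h.
apply: near_eq_cvg; apply: filterS (S_gt 1%N) => n.
by rewrite lt0n => /negbTE -> /=; rewrite subr0.
Qed.

Lemma embedded_gf_lt1 K (y : R) l : 0 <= y < 1 -> (l <= K)%N -> embedded_gf p K y l < 1.
Proof.
move=> /andP[y0 y1] lK; have y01 : 0 <= y <= 1 by rewrite y0 ltW.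
have E : forall m, (m <= K)%N -> embedded_gf p K y (K - m) < 1.
  elim=> [_|m IH mK]; first by rewrite subn0 (embedded_gf_ge X_lhbp).
  rewrite (embedded_gf_fix X_lhbp) //; last by lia.
  apply: (offspring_gf_lt1 p_law X_lhbp _ (M_up _)); first exact: (embedded_gf_unit X_lhbp).
  by rewrite (_ : (K - m.+1).+1 = K - m)%N; [apply: IH; lia|lia].
by rewrite -(subKn lK); apply: E; exact: leq_subr.
Qed.

Lemma embedded_gf_mono K (y y' : R) i : 0 <= y <= 1 -> 0 <= y' <= 1 -> y <= y' -> (i <= K)%N ->
  embedded_gf p K y i <= embedded_gf p K y' i.
Proof.
move=> y01 y'01 yy' iK.
apply: (ler_lim (@embedded_gf_cvg _ _ _ P p X X_lhbp K y y01 i) (@embedded_gf_cvg _ _ _ P p X X_lhbp K y' y'01 i)).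
apply: nearW => n.
have u01 : 0 <= (1 : R) <= 1 by rewrite ler01 lexx.
apply: (iter_gf_step_mono X_lhbp) => //; [exact: cutvec_unit|exact: cutvec_unit|].
by move=> l _; rewrite /cutvec; case: ifP.
Qed.

Definition fixed_below (K : nat) (v : nat -> R) := forall i, (i < K)%N -> v i = offspring_gf p i v.

(* Both vectors lie between the iterates started from (0, ..., 0, y) and
   (x, ..., x, y), where y is the common value at K.+1. At type K these iterates
   differ by at most E_K[x^S - 1_(S = 0)], S being the number of individuals of
   type <= K in generation n, and this vanishes in the limit by the dichotomy. *)
Lemma fixed_below_step K v w : unitvec v -> unitvec w ->
  fixed_below K.+1 v -> fixed_below K.+1 w ->
  (forall l, (l <= K)%N -> v l < 1) -> v K.+1 = w K.+1 -> v K <= w K.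
Proof.
move=> v01 w01 fv fw v1 vw.
have [x x01 vx] : exists2 x, 0 <= x < 1 & forall l, (l <= K)%N -> v l <= x.
  exists (\big[Order.max/0]_(l < K.+1) v l).
    apply/andP; split; first by rewrite bigmax_idl le_max lexx.
    by apply: bigmax_lt => // l _; apply: v1; rewrite -ltnS.
  by move=> l lK; apply: (le_bigmax _ (fun l : 'I_K.+1 => v l) (Ordinal (lK : (l < K.+1)%N))).
have x01' : 0 <= x <= 1 by case/andP: x01 => -> /ltW.
have o01 : 0 <= (0 : R) <= 1 by rewrite lexx ler01.
pose y := v K.+1.
have tu := cutvec_unit K.+1 x01' (v01 K.+1 : 0 <= y <= 1).
have bu := cutvec_unit K.+1 o01 (v01 K.+1 : 0 <= y <= 1).
rewrite -subr_le0; apply: (cvgr_to_ge (dichotomy_cvg K x01)); apply: nearW => n.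
have vt : v K <= iter n (gf_step p K.+1) (cutvec K.+1 x y) K.
  apply: (le_iter_gf_step X_lhbp) => // l; first by move=> /fv <-.
  rewrite leq_eqVlt /cutvec => /predU1P[->|lK]; first by rewrite ltnn.
  by rewrite lK vx.
have bw : iter n (gf_step p K.+1) (cutvec K.+1 0 y) K <= w K.
  apply: (iter_gf_step_le X_lhbp) => // l; first by move=> /fw <-.
  rewrite leq_eqVlt /cutvec => /predU1P[->|lK]; first by rewrite ltnn /y vw.
  by rewrite lK; have /andP[] := w01 l.
apply: (le_trans (lerB vt bw)).
rewrite -!(Ex_prod_immortal_gen X_lhbp)//.
have bm (v' : nat -> R) : unitvec v' -> bmfun (fun w => \prod_(u <- immortal_gen X K.+1 K n w) v' (type_of u)).
  move=> v'01; split.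
    exact: (immortal_gen_comp_meas X_lhbp K.+1 K n (fun s => \prod_(u <- s) v' (type_of u))).
  exists 1 => t; have /andP[? ?] := prod_unit (immortal_gen X K.+1 K n t) (f := v' \o type_of) (fun u => v'01 (type_of u)).
  by rewrite ger0_norm.
rewrite -ExB; [|exact: bm|exact: bm].
apply: Ex_le.
- by apply: bmfunB; exact: bm.
- split.
    exact: (immortal_gen_comp_meas X_lhbp K.+1 K n (fun s =>
      let c := count (fun u => (type_of u < K.+1)%N) s in x ^+ c - (c == 0)%:R)).
  exists 1 => t; case/andP: x01 => x0 x1; case: eqP => [->|_]; first by rewrite expr0 subrr normr0.
  by rewrite subr0 ger0_norm ?exprn_ge0// exprn_ile1// ltW.
move=> t; rewrite /S; set s := immortal_gen _ _ _ _ _.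
have [c0|c0] := eqVneq (count _ s) 0.
  rewrite c0 expr0 subrr subr_le0 le_eqVlt; apply/orP; left; apply/eqP.
  rewrite big_seq [RHS]big_seq; apply: eq_bigr => u us; rewrite /cutvec.
  have : ~~ has (fun u => (type_of u < K.+1)%N) s by rewrite has_count c0.
  by move=> /hasPn /(_ u us) /negbTE ->.
rewrite subr0; apply: (@le_trans _ _ (\prod_(u <- s) cutvec K.+1 x y (type_of u))).
  by rewrite gerBl; have /andP[] := prod_unit s (f := cutvec K.+1 0 y \o type_of) (fun u => bu (type_of u)).
elim: s {c0} => [|u s IH]; first by rewrite big_nil.
rewrite big_cons /= exprD; apply: ler_pM => //.
- by have /andP[] := tu (type_of u).
- by have /andP[] := prod_unit s (f := cutvec K.+1 x y \o type_of) (fun u => tu (type_of u)).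
- rewrite /cutvec; case: ifP => _; first by rewrite expr1.
  by rewrite expr0; have /andP[] := v01 K.+1.
Qed.

(** Condition (D) at k speaks only of a root of type k, so one comparison settles a single type;
    agreement then descends from K one type at a time. *)
Lemma fixed_below_unique K v w : unitvec v -> unitvec w ->
  fixed_below K v -> fixed_below K w ->
  (forall l, (l <= K)%N -> v l < 1) -> (forall l, (l <= K)%N -> w l < 1) ->
  v K = w K -> forall l, (l <= K)%N -> v l = w l.
Proof.
move=> v01 w01; elim: K => [|K IH] fv fw v1 w1 vw l.
  by rewrite leqn0 => /eqP ->.
rewrite leq_eqVlt => /predU1P[->//|lK].
apply: IH => //.
- by move=> i iK; apply: fv; lia.
- by move=> i iK; apply: fw; lia.
- by move=> i iK; apply: v1; lia.
- by move=> i iK; apply: w1; lia.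
apply/eqP; rewrite eq_le; apply/andP; split.
  by apply: fixed_below_step => // i iK; apply: v1; lia.
by apply: fixed_below_step => // i iK; apply: w1; lia.
Qed.

Lemma embedded_gf_unique K v : unitvec v -> fixed_below K v ->
  (forall l, (l <= K)%N -> v l < 1) -> forall l, (l <= K)%N -> v l = embedded_gf p K (v K) l.
Proof.
move=> v01 fv v1; have /andP[vK0 _] := v01 K; have vK1 := v1 K (leqnn K).
apply: fixed_below_unique => //.
- exact: (embedded_gf_unit X_lhbp).
- by move=> i iK; exact: (embedded_gf_fix X_lhbp).
- by move=> l lK; apply: embedded_gf_lt1 => //; rewrite vK0.
- by rewrite (embedded_gf_ge X_lhbp).
Qed.

(** Markov property of the embedded process: types rise by at most one, so a line that reaches K
    passes through m. It is an instance of uniqueness, since [embedded_gf p K y] is fixed below m as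
    well. *)
Lemma embedded_gf_comp m K (y : R) : 0 <= y < 1 -> (m <= K)%N ->
  forall l, (l <= m)%N -> embedded_gf p K y l = embedded_gf p m (embedded_gf p K y m) l.
Proof.
move=> y01 mK; have y01' : 0 <= y <= 1 by case/andP: y01 => -> /ltW.
apply: embedded_gf_unique.
- exact: (embedded_gf_unit X_lhbp).
- by move=> i im; apply: (embedded_gf_fix X_lhbp) => //; lia.
- by move=> l lm; apply: embedded_gf_lt1 => //; lia.
Qed.

(** By [offspring_gf_convex] the chord bound between 0 and 1 survives one application of G, hence
    every iteration and the limit. Its case x = 1/2 links v to u in all later estimates. *)
Lemma embedded_gf_convex K (x : R) i : 0 <= x <= 1 -> embedded_gf p K x i <= (1 - x) * embedded_gf p K 0 i + x.
Proof.
move=> x01; have o01 : 0 <= (0 : R) <= 1 by rewrite lexx ler01.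
have u01 : 0 <= (1 : R) <= 1 by rewrite ler01 lexx.
have /andP[x0 x1] := x01.
have h : (1 - x) * iter n (gf_step p K) (cutvec K 1 0) i + x @[n --> \oo] -->
    (1 - x) * embedded_gf p K 0 i + x.
  apply: cvgD; last exact: cvg_cst.
  by apply: cvgM; [exact: cvg_cst|exact: (embedded_gf_cvg X_lhbp)].
apply: (ler_cvg_to (@embedded_gf_cvg _ _ _ P p X X_lhbp K x x01 i) h).
apply: nearW => n; elim: n i {h} => [|n IH] i /=.
  by rewrite /cutvec; case: ifP => _; lra.
have b01 := iter_gf_step_unit X_lhbp K n (cutvec_unit K u01 o01).
rewrite /gf_step; case: ifP => iK; last exact: IH.
apply: le_trans (offspring_gf_convex X_lhbp i b01 x01).
apply: (offspring_gf_mono X_lhbp) => //.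
- by apply: (iter_gf_step_unit X_lhbp); exact: cutvec_unit.
- by move=> l; have := b01 l; nra.
Qed.

End Fixed.

(** * Fluctuation of the embedded process *)

Section RealInequalities.
Context {R : realFieldType}.
Implicit Types (a b u v : R).

Lemma exprn_half_le n u v : 0 <= u <= 1 -> 0 <= v <= (1 + u) / 2 -> v ^+ n <= (1 + u ^+ n) / 2.
Proof.
move=> /andP[u0 u1] /andP[v0 vu]; elim: n => [|n IH]; first by rewrite !expr0; lra.
rewrite !exprS; have un0 : 0 <= u ^+ n by rewrite exprn_ge0.
have un1 : u ^+ n <= 1 by rewrite exprn_ile1.
have : v * v ^+ n <= (1 + u) / 2 * ((1 + u ^+ n) / 2) by rewrite ler_pM// exprn_ge0.
nra.
Qed.

(** The left-hand side is (1 + a + b - 3ab) / 4, so the worst b is a if 3a < 1 and a^2 otherwise.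
    The constant is not sharp; what matters is that it lies below 1/2. *)
Lemma half_mul_sub_le a b : 0 <= a <= 1 -> a ^+ 2 <= b <= a ->
  (1 + a) / 2 * ((1 + b) / 2) - a * b <= 13 / 32.
Proof.
move=> /andP[a0 a1]; rewrite expr2 => /andP[ab ba].
suff : a + b - 3 * (a * b) <= 5 / 8 by lra.
have [a3|a3] := lerP 1 (3 * a); last by nra.
have : b * (3 * a - 1) >= a * a * (3 * a - 1) by apply: ler_wpM2r => //; lra.
suff : a + a * a * (1 - 3 * a) <= 5 / 8 by lra.
(* Tangent line at a = 1/2: a + a^2 - 3a^3 = 1/2 - a/4 - (a - 1/2)^2 (3a + 2). *)
have h : 0 <= (a - 2^-1) ^+ 2 * (3 * a + 2) by rewrite mulr_ge0 ?sqr_ge0//; lra.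
have : (a - 2^-1) ^+ 2 * (3 * a + 2) = 3 * a * a * a - a * a - 5 / 4 * a + 2^-1 by field.
nra.
Qed.

(* With v = (1 + u) / 2 the left-hand side is E[2^-B; B > 0] for B binomial with
   parameters n and 1 - u, so the point is that P(B = 1) stays away from 1. The
   exponent is split into two nearly equal halves. *)
Lemma exprn_sub_le n u v : (1 < n)%N -> 0 <= u <= 1 -> 0 <= v <= (1 + u) / 2 ->
  v ^+ n - u ^+ n <= 13 / 32.
Proof.
move=> n1 u01 vu; have /andP[u0 u1] := u01; have /andP[v0 _] := vu.
pose m := n./2; have nm : n = (m + (odd n + m))%N.
  by rewrite addnCA addnn /m odd_double_half.
have m0 : (0 < m)%N by rewrite /m; lia.
rewrite nm !exprD -[v ^+ odd n * _]exprD -[u ^+ odd n * _]exprD.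
set q := (odd n + m)%N; apply: (le_trans _ (@half_mul_sub_le (u ^+ m) (u ^+ q) _ _)).
- by apply: lerB => //; apply: ler_pM; rewrite ?exprn_ge0//; exact: exprn_half_le.
- by rewrite exprn_ge0//= exprn_ile1.
- by rewrite -exprM; apply/andP; split; apply: ler_wiXn2l => //; rewrite /q; lia.
Qed.

(** The left-hand side equals 1/2 - (1 - a)(1 - b) / 4 - ab / 2. Here a and b are the extinction
    probabilities of two groups of children, which both survive with probability at least d^2. *)
Lemma two_children_le a b d : 0 <= d <= 1 -> 0 <= a <= 1 - d -> 0 <= b <= 1 - d ->
  (1 + a) / 2 * ((1 + b) / 2) - a * b <= 2^-1 - d ^+ 2 / 4.
Proof.
move=> /andP[d0 d1] /andP[a0 ad] /andP[b0 bd]; rewrite expr2.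
have : d * d <= (1 - a) * (1 - b) by apply: ler_pM; lra.
nra.
Qed.

End RealInequalities.

Section Mid.
Context {R : realType} {d : measure_display} {T : measurableType d}.
Context (P : probability T R) (p : nat -> (nat -> nat) -> R).
Context (X : label -> T -> nat -> nat) (p_law : offspring_law p) (X_lhbp : LHBP p P X).
Context (M_up : forall i, (0 < mean_progeny p i i.+1)%E) (X_dich : dichotomy P X).

Lemma prod_cutvec m (y : R) (s : seq label) :
  \prod_(u <- s) cutvec m 1 y (type_of u) = y ^+ count (fun u => (m <= type_of u)%N) s.
Proof.
elim: s => [|u s IH]; first by rewrite big_nil.
by rewrite big_cons IH /cutvec/= ltnNge; case: leqP => _ /=; rewrite ?mul1r// exprS.
Qed.

(** Split by the number of frozen individuals in generation n: none contributes 0, one contributes v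
    - u <= (1 - u) / 2, and two or more fall under [exprn_sub_le]. *)
Lemma embedded_gf_sub_le m k u v : 0 <= u <= 1 -> 0 <= v <= (1 + u) / 2 ->
  embedded_gf p m v k - embedded_gf p m u k <= Order.max ((1 - u) / 2) (13 / 32).
Proof.
move=> u01 vu; have /andP[u0 u1] := u01; have /andP[v0 v1] := vu.
have v01 : 0 <= v <= 1 by rewrite v0/=; lra.
have h : iter n (gf_step p m) (cutvec m 1 v) k - iter n (gf_step p m) (cutvec m 1 u) k
   @[n --> \oo] --> embedded_gf p m v k - embedded_gf p m u k.
  by apply: cvgB; exact: (embedded_gf_cvg X_lhbp).
apply: (cvgr_to_le h); apply: nearW => n.
have o01 : 0 <= (1 : R) <= 1 by rewrite ler01 lexx.
rewrite -!(Ex_prod_immortal_gen X_lhbp); [|exact: cutvec_unit|exact: cutvec_unit].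
have bm (y : R) : 0 <= y <= 1 -> bmfun (fun w => \prod_(u <- immortal_gen X m k n w) cutvec m 1 y (type_of u)).
  move=> /andP[y0 y1]; split.
    exact: (immortal_gen_comp_meas X_lhbp m k n (fun s => \prod_(u <- s) cutvec m 1 y (type_of u))).
  by exists 1 => w; rewrite prod_cutvec ger0_norm ?exprn_ge0// exprn_ile1.
rewrite -ExB; [|exact: bm|exact: bm].
rewrite -[leRHS](Ex_cst P); apply: Ex_le.
- by apply: bmfunB; exact: bm.
- exact: bmfun_cst.
move=> w; rewrite !prod_cutvec; case: (count _ _) => [|[|c]].
- by rewrite !expr0 subrr le_max; apply/orP; right; lra.
- by rewrite !expr1 le_max; apply/orP; left; lra.
- by rewrite le_max exprn_sub_le// orbT.
Qed.

Lemma embedded_gf_half_le K i : embedded_gf p K (2^-1) i <= (1 + embedded_gf p K 0 i) / 2.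
Proof.
have x01 : 0 <= (2^-1 : R) <= 1 by apply/andP; split; lra.
by have := embedded_gf_convex X_lhbp K i x01; lra.
Qed.

(* The hypothesis makes Y_K = 1 likely under P_k. Conditionally on Y_m = N, the
   event Y_K = 1 requires exactly one of N lines to survive, which is unlikely
   unless N = 1 and a line started from m dies with small probability. *)
Lemma embedded_gf0_lt K k m : (k <= m)%N -> (m <= K)%N ->
  13 / 32 < embedded_gf p K (2^-1) k - embedded_gf p K 0 k -> embedded_gf p K 0 m < 3 / 16.
Proof.
move=> km mK.
have x01 : 0 <= (2^-1 : R) <= 1 by apply/andP; split; lra.
have o01 : 0 <= (0 : R) <= 1 by apply/andP; split; lra.
have := @embedded_gf_sub_le m k (embedded_gf p K 0 m) (embedded_gf p K (2^-1) m) (embedded_gf_unit X_lhbp _ o01 _).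
rewrite (embedded_gf_comp p_law X_lhbp M_up X_dich _ mK km); last by apply/andP; split; lra.
rewrite [embedded_gf p K 0 k](embedded_gf_comp p_law X_lhbp M_up X_dich _ mK km); last by apply/andP; split; lra.
rewrite embedded_gf_half_le; have /andP[-> _] := embedded_gf_unit X_lhbp K x01 m.
move=> /(_ isT) h1 h2; have := lt_le_trans h2 h1.
(* (1 - u) / 2 > 13 / 32 means u < 3 / 16. *)
by rewrite lt_max => /orP[]; lra.
Qed.

End Mid.

(** * Only children and the excess they carry *)

Definition unit_offspring (j : nat) : nat -> nat := fun l => l == j.

Section SingleLine.
Context {R : realType} {d : measure_display} {T : measurableType d}.
Context (P : probability T R) (p : nat -> (nat -> nat) -> R).
Context (X : label -> T -> nat -> nat) (p_law : offspring_law p) (X_lhbp : LHBP p P X).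
Context (M_up : forall i, (0 < mean_progeny p i i.+1)%E).

Let XO u w : offspring_set (type_of u) (X u w).
Proof. by have [] := X_lhbp. Qed.

Let root i : label := (i, [::]).

Definition qprob i j : R := \int[P]_w (X (root i) w == unit_offspring j :> (nat -> nat))%:R.

Definition single_prob i : R := \int[P]_w (offspring_size i (X (root i) w) == 1%N)%:R.

Lemma offspring_size1 i r : offspring_set i r ->
  offspring_size i r = 1%N -> exists2 j, (j < i.+2)%N & r = unit_offspring j.
Proof.
move=> ir r1.
have [j rj] : exists j : 'I_i.+2, (0 < r j)%N.
  apply: contrapT => no; move: r1; rewrite /offspring_size big1// => l _.
  by apply/eqP; rewrite -leqn0 leqNgt; apply/negP => rl; apply: no; exists l.
exists j => //; apply/funext => l.
move: r1; rewrite /offspring_size (bigD1 j)//= => r1.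
have [rj1 r0] : r j = 1%N /\ (\sum_(i0 < i.+2 | i0 != j) r i0 = 0)%N.
  by move: r1 rj; set s := (\sum_(_ < _ | _) _)%N; lia.
rewrite /unit_offspring; case: eqVneq => [->//|lj].
have [li|li] := ltnP l i.+2; last by rewrite ir.
by move/eqP: r0; rewrite sum_nat_eq0 => /forallP /(_ (Ordinal li)) /implyP /(_ lj) /eqP.
Qed.

Lemma offspring_size_unit i j : (j < i.+2)%N -> offspring_size i (unit_offspring j) = 1%N.
Proof.
move=> ji; rewrite /offspring_size (bigD1 (Ordinal ji))//= /unit_offspring eqxx big1// => l.
by rewrite -val_eqE/= => /negbTE ->.
Qed.

Lemma unit_offspring_inj j k : unit_offspring j = unit_offspring k -> j = k.
Proof. by move=> /(congr1 (@^~ j)); rewrite /unit_offspring eqxx; case: eqP. Qed.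

Lemma p1E i : p1 p i = (single_prob i)%:E.
Proof.
have b : bmfun (fun w => (offspring_size i (X (root i) w) == 1%N)%:R : R).
  apply: (bmfun_offspring X_lhbp (root i) (f := fun r => (offspring_size i r == 1%N)%:R) (M := 1)) => r.
  by case: eqP => _; rewrite ?normr1 ?normr0.
rewrite /single_prob EFin_Ex// -(esum_offspring X_lhbp (root i)
  (f := fun r => (offspring_size i r == 1%N)%:R))//=.
rewrite /p1 esum_mkcond [RHS]esum_mkcond; apply: eq_esum => r _.
case: ifPn => [|nr].
  by rewrite inE => -[ir r1]; rewrite mem_set// r1 eqxx mulr1.
case: ifPn => //; rewrite inE => ir; case: eqP => r1; last by rewrite mulr0.
by move: nr; rewrite mem_set.
Qed.

Lemma sum_unit_offspring i r : offspring_set i r ->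
  \sum_(j < i.+2) (r == unit_offspring j :> (nat -> nat))%:R = (offspring_size i r == 1%N)%:R :> R.
Proof.
move=> ir; case: eqP => [r1|r1].
  have [j ji ->] := offspring_size1 ir r1.
  rewrite (bigD1 (Ordinal ji))//= eqxx big1 ?addr0// => l.
  rewrite -val_eqE/= => lj; case: eqP => // /unit_offspring_inj E.
  by move: lj; rewrite E eqxx.
rewrite big1// => j _; case: eqP => // rj.
by case: r1; rewrite rj offspring_size_unit.
Qed.

Lemma bmfun_unit i j : bmfun (fun w => (X (root i) w == unit_offspring j :> (nat -> nat))%:R : R).
Proof.
apply: (bmfun_offspring X_lhbp (root i) (f := fun r => (r == unit_offspring j :> (nat -> nat))%:R) (M := 1)) => r.
by case: eqP => _; rewrite ?normr1 ?normr0.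
Qed.

Lemma bmfun_sum n (f : nat -> T -> R) : (forall j, bmfun (f j)) -> bmfun (fun w => \sum_(j < n) f j w).
Proof.
move=> bf; elim: n => [|n IH].
  by under eq_fun do rewrite big_ord0; exact: bmfun_cst.
by under eq_fun do rewrite big_ord_recr/=; exact: bmfunD.
Qed.

Lemma Ex_sum n (f : nat -> T -> R) : (forall j, bmfun (f j)) ->
  \int[P]_w (\sum_(j < n) f j w) = \sum_(j < n) \int[P]_w f j w.
Proof.
move=> bf; elim: n => [|n IH].
  by under eq_Rintegral do rewrite big_ord0; rewrite big_ord0 Ex_cst.
under eq_Rintegral do rewrite big_ord_recr/=.
by rewrite ExD ?big_ord_recr/= ?IH//; exact: bmfun_sum.
Qed.

Lemma sum_qprob i : \sum_(j < i.+2) qprob i j = single_prob i.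
Proof.
rewrite -(Ex_sum _ (bmfun_unit i)); apply: eq_Rintegral => w _.
by rewrite sum_unit_offspring//; exact: (@XO (root i)).
Qed.

Lemma qprob_ge0 i j : 0 <= qprob i j.
Proof. exact: Rintegral_ge0. Qed.

Lemma single_prob_01 i : 0 <= single_prob i <= 1.
Proof.
apply/andP; split; first exact: Rintegral_ge0.
rewrite -[leRHS](Ex_cst P); apply: Ex_le.
- apply: (bmfun_offspring X_lhbp (root i) (f := fun r => (offspring_size i r == 1%N)%:R) (M := 1)) => r.
  by case: eqP => _; rewrite ?normr1 ?normr0.
- exact: bmfun_cst.
by move=> w; case: eqP.
Qed.

(** M_(i,i+1) > 0 makes some offspring with a child of type i+1 possible, and this excludes an only
    child of type at most i. The strict inequality permits division by 1 - Q in the recursion for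
    the excess. *)
Lemma sum_qprob_lt1 i : \sum_(j < i.+1) qprob i j < 1.
Proof.
have [r [ir pr rj _]] := mean_progeny_gt0 p_law (M_up i).
have [_ _ XP _] := X_lhbp.
have mA : measurable (X (root i) @^-1` [set r]) by exact: (offspring_preimage X_lhbp).
have bA : bmfun (\1_(X (root i) @^-1` [set r]) : T -> R) by exact: bmfun_indic.
have bS := bmfun_sum i.+1 (bmfun_unit i).
suff : \sum_(j < i.+1) qprob i j + p i r <= 1 by lra.
rewrite -(Ex_sum _ (bmfun_unit i)).
rewrite (_ : p i r = \int[P]_w (\1_(X (root i) @^-1` [set r]) w)); last first.
  by rewrite Ex_indic// (XP (root i)).
rewrite -ExD// -[leRHS](Ex_cst P); apply: Ex_le => //; first exact: bmfunD.
  exact: bmfun_cst.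
move=> w; rewrite indicE; have [|_] := boolP (w \in _).
  rewrite inE => /= Xr; rewrite big1 ?add0r// => j _; case: eqP => // E.
  move: rj; rewrite -Xr E /unit_offspring; case: eqP => // ij.
  by have := ltn_ord j; rewrite -ij ltnn.
rewrite addr0 (le_trans _ (_ : (offspring_size i (X (root i) w) == 1%N)%:R <= 1))//.
  rewrite -(sum_unit_offspring (@XO (root i) w)) [leRHS]big_ord_recr.
  by rewrite lerDl.
by case: eqP.
Qed.

End SingleLine.

Definition monomial {R : realType} n (v : nat -> R) (r : nat -> nat) : R :=
  \prod_(l < n) v l ^+ r l.

Section Monomials.
Context {R : realType}.
Implicit Types (u v : nat -> R).

Lemma monomial_half_le n u v r : unitvec u -> unitvec v ->
  (forall l, (l < n)%N -> v l <= (1 + u l) / 2) ->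
  monomial n v r <= (1 + monomial n u r) / 2.
Proof.
move=> u01 v01 vu.
suff [] : [/\ monomial n v r <= (1 + monomial n u r) / 2, 0 <= monomial n v r
  & 0 <= monomial n u r <= 1] by [].
apply: (big_ind2 (fun a b => [/\ a <= (1 + b) / 2, 0 <= a & 0 <= b <= 1])).
- by split; lra.
- move=> a1 b1 a2 b2 [h1 a10 /andP[b10 b11]] [h2 a20 /andP[b20 b21]]; split.
  + have : a1 * a2 <= (1 + b1) / 2 * ((1 + b2) / 2) by rewrite ler_pM.
    by nra.
  + exact: mulr_ge0.
  + by rewrite mulr_ge0//= mulr_ile1.
move=> l _; have /andP[ul0 ul1] := u01 l; have /andP[vl0 _] := v01 l; split.
- by apply: exprn_half_le; [rewrite ul0|rewrite vl0 vu].
- exact: exprn_ge0.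
- by rewrite exprn_ge0//= exprn_ile1.
Qed.

Lemma monomialD n v r1 r2 :
  monomial n v (fun l => r1 l + r2 l)%N = monomial n v r1 * monomial n v r2.
Proof. by rewrite /monomial -big_split; apply: eq_bigr => l _; rewrite exprD. Qed.

Lemma monomial_unit_offspring n v j : (j < n)%N -> monomial n v (unit_offspring j) = v j.
Proof.
move=> jn; rewrite /monomial (bigD1 (Ordinal jn))//= /unit_offspring eqxx expr1.
by rewrite big1 ?mulr1// => l; rewrite -val_eqE/= => /negbTE ->; rewrite expr0.
Qed.

Lemma monomial_01 n v r : unitvec v -> 0 <= monomial n v r <= 1.
Proof.
move=> v01; apply: prod_unit => l; have /andP[? ?] := v01 l.
by rewrite exprn_ge0//= exprn_ile1.
Qed.

Lemma monomial_split n v r j : (j < n)%N -> (0 < r j)%N ->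
  monomial n v r = v j * monomial n v (fun l => r l - unit_offspring j l)%N.
Proof.
move=> jn rj; rewrite -{1}(monomial_unit_offspring v jn) -monomialD.
congr monomial; apply/funext => l; rewrite /unit_offspring.
by case: eqVneq => [->|_] /=; lia.
Qed.

Lemma monomial_le n v r j : unitvec v -> (j < n)%N -> (0 < r j)%N -> monomial n v r <= v j.
Proof.
move=> v01 jn rj; rewrite (monomial_split v jn rj); have /andP[vj _] := v01 j.
by rewrite ler_piMr//; have /andP[] := monomial_01 n (fun l => r l - unit_offspring j l)%N v01.
Qed.

(* 2^-1 - d ^+ 2 / 4 bounds E[2^-Y - 1_(Y = 0)] when there are two or more
   children, each of whose lines survives with probability at least d. What
   exceeds it can only come from having exactly one child. *)
Definition excess (d : R) u v (j : nat) : R :=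
  Order.max (v j - u j - (2^-1 - d ^+ 2 / 4)) 0.

Lemma excess_ge0 d u v j : 0 <= excess d u v j.
Proof. by rewrite le_max lexx orbT. Qed.

Lemma monomial_excess_le i d u v r : unitvec u -> unitvec v -> 0 <= d <= 1 ->
  (forall l, (l < i.+2)%N -> v l <= (1 + u l) / 2) ->
  (forall l, (l < i.+2)%N -> u l <= 1 - d) ->
  offspring_set i r ->
  monomial i.+2 v r - monomial i.+2 u r - (2^-1 - d ^+ 2 / 4) <=
  \sum_(j < i.+2) (r == unit_offspring j :> (nat -> nat))%:R * excess d u v j.
Proof.
move=> u01 v01 d01 vu ud ir.
have [d0 d1] : 0 <= d /\ d <= 1 by apply/andP.
have dd : d ^+ 2 <= 1 by rewrite exprn_ile1.
have S0 : 0 <= \sum_(j < i.+2) (r == unit_offspring j :> (nat -> nat))%:R * excess d u v j.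
  by apply: sumr_ge0 => j _; rewrite mulr_ge0 ?excess_ge0.
have [[j rj]|no] := pselect (exists j : 'I_i.+2, (0 < r j)%N); last first.
  have r0 l : (l < i.+2)%N -> r l = 0%N.
    move=> li; apply/eqP; rewrite -leqn0 leqNgt; apply/negP => rl.
    by apply: no; exists (Ordinal li).
  apply: le_trans S0; rewrite /monomial !big1 ?subrr ?sub0r; first lra.
  + by move=> l _; rewrite r0// expr0.
  + by move=> l _; rewrite r0// expr0.
have ji := ltn_ord j.
have [E|rNj] := pselect (r = unit_offspring j).
  rewrite E !monomial_unit_offspring// (bigD1 j)//= eqxx mul1r.
  apply: (@le_trans _ _ (excess d u v j)); first by rewrite le_max lexx.
  rewrite lerDl; apply: sumr_ge0 => k _; by rewrite mulr_ge0 ?excess_ge0.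
apply: le_trans S0; rewrite subr_le0.
(* Two or more children: one of type j is set aside, and the rest r' still contains some k.
   [two_children_le] is applied with a = u j and b the monomial of r', which is at most u k. *)
set r' := fun l => (r l - unit_offspring j l)%N.
have [k ki rk] : exists2 k, (k < i.+2)%N & (0 < r' k)%N.
  apply: contrapT => no; apply: rNj; apply/funext => l.
  have [li|li] := ltnP l i.+2.
    have : r' l = 0%N.
      apply/eqP; rewrite -leqn0 leqNgt; apply/negP => rl.
      by apply: no; exists l.
    by rewrite /r' /unit_offspring; case: eqVneq => [->|_] /=; lia.
  by rewrite ir// /unit_offspring; case: eqP => // lj; lia.
rewrite !(monomial_split _ ji rj) -/r'.
have uk : monomial i.+2 u r' <= 1 - d by apply: le_trans (ud k ki); exact: monomial_le.
have /andP[m0 _] := monomial_01 i.+2 r' u01.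
have /andP[m0' _] := monomial_01 i.+2 r' v01.
have /andP[uj0 _] := u01 j; have /andP[vj0 _] := v01 j.
apply: le_trans (two_children_le d01 (_ : 0 <= u j <= 1 - d) (_ : 0 <= monomial i.+2 u r' <= 1 - d)).
- by rewrite lerB// ler_pM ?vu ?monomial_half_le.
- by rewrite uj0 ud.
- by rewrite m0.
Qed.

End Monomials.

Section Contradiction.
Context {R : realType} {d : measure_display} {T : measurableType d}.
Context (P : probability T R) (p : nat -> (nat -> nat) -> R).
Context (X : label -> T -> nat -> nat) (p_law : offspring_law p) (X_lhbp : LHBP p P X).
Context (M_up : forall i, (0 < mean_progeny p i i.+1)%E) (X_dich : dichotomy P X).

Let root i : label := (i, [::]).

(** This is [monomial_excess_le] in expectation: u and v are fixed at i, so the monomials integrate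
    to u i and v i. *)
Lemma excess_subharmonic i (e : R) (u v : nat -> R) : unitvec u -> unitvec v -> 0 <= e <= 1 ->
  (forall l, (l < i.+2)%N -> v l <= (1 + u l) / 2) ->
  (forall l, (l < i.+2)%N -> u l <= 1 - e) ->
  u i = offspring_gf p i u -> v i = offspring_gf p i v ->
  excess e u v i <= \sum_(j < i.+2) qprob P X i j * excess e u v j.
Proof.
move=> u01 v01 e01 vu ue ui vi.
rewrite {1}/excess ge_max; apply/andP; split; last first.
  by apply: sumr_ge0 => j _; rewrite mulr_ge0 ?excess_ge0// qprob_ge0.
rewrite ui vi !(offspring_gf_Ex X_lhbp)//.
have bu := bmfun_monom X_lhbp (root i) u01.
have bv := bmfun_monom X_lhbp (root i) v01.
rewrite -ExB// -[X in _ - X <= _](Ex_cst P) -ExB; last 2 first.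
- exact: bmfunB.
- exact: bmfun_cst.
have bq j : bmfun (fun w => (X (root i) w == unit_offspring j :> (nat -> nat))%:R * excess e u v j).
  by apply: bmfunM; [exact: (bmfun_unit X_lhbp)|exact: bmfun_cst].
rewrite (_ : \sum_(j < _) _ = \int[P]_w (\sum_(j < i.+2)
    (X (root i) w == unit_offspring j :> (nat -> nat))%:R * excess e u v j)); last first.
  rewrite (Ex_sum P i.+2 bq); apply: eq_bigr => j _.
  rewrite mulrC -ExZ; last exact: (bmfun_unit X_lhbp).
  by apply: eq_Rintegral => w _; rewrite mulrC.
apply: Ex_le.
- by apply: bmfunB; [exact: bmfunB|exact: bmfun_cst].
- exact: (bmfun_sum i.+2 bq).
move=> w; apply: monomial_excess_le => //.
by have [XO _ _ _] := X_lhbp; exact: (XO (root i) w).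
Qed.

(** An only child of type i has type at most i+1, and by induction the excess is nondecreasing on
    the types up to i. Lower types can thus be replaced by i, and the resulting inequality solved
    for the excess at i. *)
Lemma excess_le K (e : R) (u v : nat -> R) : unitvec u -> unitvec v -> 0 <= e <= 1 ->
  (forall l, (l <= K)%N -> v l <= (1 + u l) / 2) ->
  (forall l, (l <= K)%N -> u l <= 1 - e) ->
  fixed_below p K u -> fixed_below p K v ->
  forall i, (i < K)%N -> excess e u v i <= single_prob P X i * excess e u v i.+1.
Proof.
move=> u01 v01 e01 vu ue fu fv.
elim/ltn_ind => i IH iK.
have mono j k : (j <= k)%N -> (k <= i)%N -> excess e u v j <= excess e u v k.
  elim: k => [|k IHk]; first by rewrite leqn0 => /eqP ->.
  rewrite leq_eqVlt => /predU1P[->//|jk] ki.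
  apply: (le_trans (IHk jk (ltnW ki))); apply: (le_trans (IH k ki _)); first by lia.
  by rewrite ler_piMl ?excess_ge0//; have /andP[] := single_prob_01 X_lhbp k.
have := @excess_subharmonic i e u v u01 v01 e01 _ _ (fu i iK) (fv i iK).
have lK l : (l < i.+2)%N -> (l <= K)%N by lia.
move=> /(_ (fun l li => vu l (lK l li)) (fun l li => ue l (lK l li))).
have Ei := excess_ge0 e u v i; have Ei1 := excess_ge0 e u v i.+1.
have Q1 := sum_qprob_lt1 p_law X_lhbp M_up i.
have := sum_qprob X_lhbp i; rewrite !big_ord_recr/= -/(qprob _ _ _ _).
rewrite big_ord_recr/= in Q1.
set Q := (X in X + _ = _ -> _); set q := qprob P X i i.+1; set a := single_prob P X i.
move=> Qqa h.
have QE : \sum_(j < i) qprob P X i j * excess e u v j + qprob P X i i * excess e u v i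
    <= Q * excess e u v i.
  rewrite /Q mulrDl lerD2r mulr_suml; apply: ler_sum => j _.
  by apply: ler_wpM2l; [exact: qprob_ge0|apply: mono => //; exact: ltnW].
have Q0 : 0 <= Q by rewrite addr_ge0 ?qprob_ge0// sumr_ge0// => j _; exact: qprob_ge0.
have /andP[a0 a1] : 0 <= a <= 1 by exact: (single_prob_01 X_lhbp).
have Q1' : 0 < 1 - Q by rewrite subr_gt0.
(* excess i <= Q * excess i + (a - Q) * excess i.+1, where a - Q <= a * (1 - Q). *)
rewrite -(ler_pM2l Q1'); apply: (@le_trans _ _ ((a - Q) * excess e u v i.+1)); last first.
  rewrite mulrA; apply: ler_wpM2r => //; nra.
have -> : a - Q = q by rewrite -Qqa addrAC subrr add0r.
by rewrite mulrBl mul1r lerBlDr; apply: (le_trans h); rewrite addrC lerD2l.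
Qed.

Lemma excess_prod_le K (e : R) (u v : nat -> R) : unitvec u -> unitvec v -> 0 <= e <= 1 ->
  (forall l, (l <= K)%N -> v l <= (1 + u l) / 2) ->
  (forall l, (l <= K)%N -> u l <= 1 - e) ->
  fixed_below p K u -> fixed_below p K v ->
  forall k, (k <= K)%N -> excess e u v k <= \prod_(k <= m < K) single_prob P X m.
Proof.
move=> u01 v01 e01 vu ue fu fv k kK.
have [d0 d1] : 0 <= e /\ e <= 1 by apply/andP.
have dd : e ^+ 2 <= 1 by rewrite exprn_ile1.
suff E n : (n <= K - k)%N ->
    excess e u v (K - n) <= \prod_(K - n <= m < K) single_prob P X m.
  by have := E (K - k)%N (leqnn _); rewrite subKn.
elim: n => [_|n IH nK].
  rewrite subn0 big_geq// /excess ge_max ler01 andbT.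
  have /andP[_ ?] := v01 K; have /andP[? _] := u01 K.
  have : 0 <= 2^-1 - e ^+ 2 / 4 by lra.
  lra.
have nK' : (K - n.+1 < K)%N by lia.
apply: (le_trans (excess_le u01 v01 e01 vu ue fu fv nK')).
rewrite big_ltn//; apply: ler_wpM2l; first by have /andP[] := single_prob_01 X_lhbp (K - n.+1).
by rewrite (_ : (K - n.+1).+1 = K - n)%N; [apply: IH; lia|lia].
Qed.

Context (p1_div : (\sum_(0 <= i <oo) (1 - p1 p i) = +oo)%E).

Lemma prod_single_prob_small k (c : R) : 0 < c ->
  \forall K \near \oo, \prod_(k <= m < K) single_prob P X m < c.
Proof.
move=> c0; pose a m : R := 1 - single_prob P X m.
have a0 m : 0 <= a m <= 1 by have := single_prob_01 X_lhbp m; rewrite /a; lra.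
have h : (\sum_(0 <= i < K) (a i)%:E)%E @[K --> \oo] --> (+oo%E : \bar R).
  have : cvgn (fun K => \sum_(0 <= i < K) (a i)%:E)%E.
    by apply: is_cvg_nneseries => m _ _; rewrite lee_fin; have /andP[] := a0 m.
  move=> /cvg_ex[l hl]; have := hl.
  have -> : l = +oo%E; last by [].
  rewrite -p1_div -(cvg_lim (@ereal_hausdorff R) hl); congr (limn _).
  apply/funext => K; apply: eq_bigr => m _.
  by rewrite (p1E X_lhbp) EFinB.
(* The first k terms of the sum are at most k, so the terms from k on reach - ln (c / 2), and the
   product is at most c / 2. *)
have [K0 _ HK] := (cvgeyPge _).1 h (k%:R - ln (c / 2)).
exists (maxn K0 k) => // K /=; rewrite geq_max => /andP[K0K kK].
apply: (@le_lt_trans _ _ (expR (- \sum_(k <= m < K) a m))).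
  rewrite -sumrN expR_sum; apply: ler_prod => m _.
  have /andP[-> _] /= := single_prob_01 X_lhbp m.
  by have := expR_ge1Dx (- a m); rewrite /a opprB addrC subrK.
have := HK K K0K; rewrite /= sumEFin lee_fin (big_cat_nat (n := k))//= => hs.
have sk : \sum_(0 <= i < k) a i <= k%:R.
  have -> : k%:R = \sum_(0 <= i < k) (1 : R) by rewrite sumr_const_nat subn0.
  by apply: ler_sum => m _; have /andP[] := a0 m.
have hl : - \sum_(k <= m < K) a m <= ln (c / 2) by lra.
rewrite -ler_expR lnK in hl; last by rewrite posrE divr_gt0.
by apply: (le_lt_trans hl); rewrite ltr_pdivrMr// ltr_pMr// ltr1n.
Qed.

End Contradiction.

Section NoSeparation.
Context {R : realType} {d : measure_display} {T : measurableType d}.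
Context (P : probability T R) (p : nat -> (nat -> nat) -> R).
Context (X : label -> T -> nat -> nat) (p_law : offspring_law p) (X_lhbp : LHBP p P X).
Context (M_up : forall i, (0 < mean_progeny p i i.+1)%E) (X_dich : dichotomy P X).
Context (p1_div : (\sum_(0 <= i <oo) (1 - p1 p i) = +oo)%E).

Context (f : nat -> nat) (f_ge : forall j, (j <= f j)%N)
  (f_mono : forall i j, (i <= j)%N -> (f i <= f j)%N).
(** This is all that is retained of the law of W. The two indices are independent, so levels f j and
    f l can be compared in either order. *)
Context (sep : forall a b : R, 0 < a -> a < b -> b < 1 ->
  exists N, forall j l, (N <= j)%N -> (N <= l)%N -> embedded_gf p (f j) a 0%N < embedded_gf p (f l) b 0%N).

(* E_0[y^(Y_(f l))] is the value at embedded_gf p (f l) y (f j) of E_0[z^(Y_(f j))] as a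
   function of z, so separation forces embedded_gf p (f l) y (f j) to be close to y. *)
Lemma near_identity (e : R) : 0 < e < 4^-1 -> exists N, forall j l, (N <= j)%N -> (j <= l)%N ->
  2^-1 - e < embedded_gf p (f l) (2^-1) (f j) /\ embedded_gf p (f l) 0 (f j) < e.
Proof.
move=> /andP[e0 e4].
(* The first pair bounds the value at 1/2 from below, the second the value at 0 from above. *)
have [|||N1 H1] := sep (a := 2^-1 - e) (b := 2^-1); [lra..|].
have [|||N2 H2] := sep (a := e / 2) (b := e); [lra..|].
have comp j l y : 0 <= y < 1 -> (j <= l)%N -> embedded_gf p (f l) y 0%N = embedded_gf p (f j) (embedded_gf p (f l) y (f j)) 0%N.
  by move=> y01 jl; apply: (embedded_gf_comp p_law X_lhbp M_up X_dich y01 (f_mono jl)).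
have unit y j l : 0 <= y <= 1 -> 0 <= embedded_gf p (f l) y (f j) <= 1 by move=> y01; exact: (embedded_gf_unit X_lhbp).
have h01 : 0 <= (2^-1 : R) <= 1 by apply/andP; split; lra.
have z01 : 0 <= (0 : R) <= 1 by apply/andP; split; lra.
have e01 : 0 <= e <= 1 by apply/andP; split; lra.
have e201 : 0 <= e / 2 <= 1 by apply/andP; split; lra.
exists (maxn N1 N2) => j l; rewrite geq_max => /andP[N1j N2j] jl; split.
  have := H1 j l N1j (leq_trans N1j jl); rewrite (comp j l) //; last by lra.
  apply: contraTT; rewrite -!leNgt => h; apply: (embedded_gf_mono X_lhbp) => //; first exact: unit.
  by apply/andP; split; lra.
have := H2 l j (leq_trans N2j jl) N2j; rewrite (comp j l) //; last by apply/andP; split; lra.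
(* [sep] excludes the point 0, which is therefore replaced by e / 2 through monotonicity. *)
move=> h; apply: (@le_lt_trans _ _ (embedded_gf p (f l) (e / 2) (f j))).
  by apply: (embedded_gf_mono X_lhbp) => //; [lra|exact: f_mono].
move: h; apply: contraTT; rewrite -!leNgt => h; apply: (embedded_gf_mono X_lhbp) => //; exact: unit.
Qed.

(** Types from k = f N on satisfy the bound 3/16. A smaller type has to reach k first, and the
    finitely many values of H_k(3/16) at types up to k are all below 1. *)
Lemma embedded_gf0_le_uniform : exists e N, [/\ 0 < e, e <= 2^-1 & forall l m, (N <= l)%N -> (m <= f l)%N ->
  embedded_gf p (f l) 0 m <= 1 - e].
Proof.
(* 2^-1 - 2 / 64 = 15 / 32 exceeds the threshold 13 / 32 of [embedded_gf0_lt]. *)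
have [|N HN] := near_identity (e := 64^-1); first by apply/andP; split; lra.
pose k := f N.
have s01 : 0 <= (3 / 16 : R) < 1 by apply/andP; split; lra.
have s01' : 0 <= (3 / 16 : R) <= 1 by apply/andP; split; lra.
have z01 : 0 <= (0 : R) < 1 by apply/andP; split; lra.
have z01' : 0 <= (0 : R) <= 1 by apply/andP; split; lra.
pose x := \big[Order.max/2^-1]_(m < k.+1) embedded_gf p k (3 / 16) m.
have x1 : x < 1.
  apply: bigmax_lt => [|m _]; first by lra.
  by apply: (embedded_gf_lt1 p_law X_lhbp M_up); rewrite // -ltnS.
have x2 : 2^-1 <= x by rewrite /x bigmax_idl le_max lexx.
exists (1 - x), N; split; [lra|lra|] => l m Nl ml; rewrite subKr.
have kl : (k <= f l)%N by exact: f_mono.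
have [h1 h2] := HN N l (leqnn N) Nl.
have lt m' : (k <= m')%N -> (m' <= f l)%N -> embedded_gf p (f l) 0 m' < 3 / 16.
  move=> km' m'l; apply: (embedded_gf0_lt p_law X_lhbp M_up X_dich km' m'l); rewrite -/k in h1 h2 *; lra.
have [km|mk] := leqP k m; first by have := lt m km ml; lra.
rewrite (embedded_gf_comp p_law X_lhbp M_up X_dich z01 kl (ltnW mk)).
apply: (@le_trans _ _ (embedded_gf p k (3 / 16) m)).
  apply: (embedded_gf_mono X_lhbp) => //; [exact: (embedded_gf_unit X_lhbp)| |exact: ltnW].
  by apply: ltW; exact: lt.
exact: (le_bigmax _ (fun m : 'I_k.+1 => embedded_gf p k (3 / 16) m) (Ordinal (ltnW mk : (m < k.+1)%N))).
Qed.

Lemma no_separation : False.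
Proof.
have [e [N [e0 e2 He]]] := embedded_gf0_le_uniform.
have e01 : 0 <= e <= 1 by apply/andP; split; lra.
have ee : 0 < e ^+ 2 by rewrite exprn_gt0.
have ee1 : e ^+ 2 <= 1 by rewrite exprn_ile1//; lra.
(* With both errors below e^2 / 16, v - u exceeds 1/2 - e^2 / 8 at k, which leaves an excess of at
   least e^2 / 4 - e^2 / 8 = e^2 / 8. *)
have [|N' HN'] := near_identity (e := e ^+ 2 / 16); first by apply/andP; split; lra.
have h01 : 0 <= (2^-1 : R) <= 1 by apply/andP; split; lra.
have z01 : 0 <= (0 : R) <= 1 by apply/andP; split; lra.
pose k := f N'.
have c0 : 0 < e ^+ 2 / 8 by lra.
have [K0 _ HK0] := prod_single_prob_small X_lhbp p1_div k c0.
pose l := maxn (maxn K0 N) N'.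
have Nl : (N <= l)%N by rewrite /l !leq_max leqnn orbT.
have N'l : (N' <= l)%N by rewrite /l leq_max leqnn orbT.
have K0l : (K0 <= l)%N by rewrite /l !leq_max leqnn.
have kl : (k <= f l)%N by exact: f_mono.
have : \prod_(k <= m < f l) single_prob P X m < e ^+ 2 / 8.
  by apply: HK0 => /=; exact: leq_trans (f_ge l).
have [h1 h2] := HN' N' l (leqnn _) N'l; rewrite -/k in h1 h2.
have h := excess_prod_le p_law X_lhbp M_up (embedded_gf_unit X_lhbp (f l) z01) (embedded_gf_unit X_lhbp (f l) h01) e01
  (fun m _ => embedded_gf_half_le X_lhbp (f l) m) (fun m => He l m Nl)
  (fun m => embedded_gf_fix X_lhbp z01 (i := m)) (fun m => embedded_gf_fix X_lhbp h01 (i := m)) kl.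
have : e ^+ 2 / 8 <= excess e (embedded_gf p (f l) 0) (embedded_gf p (f l) 2^-1) k.
  by rewrite /excess le_max; apply/orP; left; lra.
by move=> h3 h4; have := lt_le_trans h4 (le_trans h3 h); rewrite ltxx.
Qed.

End NoSeparation.

(** * The embedded process and its limit *)

Section SterileImmortal.
Context (m : nat) (off : label -> nat -> nat).
Let I := immortal (m%:Z - 1) off.
Let S := sterile (m%:Z - 1) off.
Let hi (u : label) := (m <= type_of u)%N.
Let lo (u : label) := (type_of u < m)%N.

Let loN u : lo u = ~~ hi u. Proof. by rewrite /lo /hi ltnNge. Qed.

Lemma children_immortal_lo u : lo u -> children I u = children off u.
Proof. by rewrite loN /I /children immortal_subSE => /negbTE; rewrite /hi => ->. Qed.

Lemma children_immortal_hi u : hi u -> children I u = [:: (u.1, rcons u.2 (type_of u, 0%N))].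
Proof.
rewrite /hi => mu; rewrite /I /children immortal_subSE mu.
rewrite -addn2 iotaD map_cat flatten_cat add0n /= eqxx.
rewrite (_ : (_ == _) = false)/=; last by apply/eqP; lia.
have : all (fun l => l != type_of u) (iota 0 (type_of u)).
  by apply/allP => l; rewrite mem_iota add0n neq_ltn => /andP[_ ->].
elim: (iota 0 _) => //= l s IH /andP[/negbTE -> /IH h]; exact: h.
Qed.

Lemma sterile_subSE u : S u = if hi u then (fun=> 0%N) else off u.
Proof. by rewrite /S /sterile /hi; congr (if _ then _ else _); apply/idP/idP; lia. Qed.

Lemma children_sterile_lo u : lo u -> children S u = children off u.
Proof. by rewrite loN /children sterile_subSE => /negbTE ->. Qed.

Lemma children_sterile_hi u : hi u -> children S u = [::].
Proof.
move=> hu; rewrite /children sterile_subSE hu.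
by elim: (iota 0 (type_of u).+2).
Qed.

Lemma filter_lo_flatten (g : label -> seq label) us :
  (forall u, lo u -> g u = children off u) ->
  (forall u, hi u -> [seq c <- g u | lo c] = [::]) ->
  [seq c <- flatten (map g us) | lo c] =
  [seq c <- flatten [seq children off u | u <- us & lo u] | lo c].
Proof.
move=> glo ghi; elim: us => //= u us IH; rewrite filter_cat IH.
have [hu|lu] := boolP (hi u); first by rewrite ghi// loN hu.
by rewrite loN lu /= filter_cat glo// loN.
Qed.

Lemma filter_lo_generation i n :
  [seq u <- generation I i n | lo u] = [seq u <- generation S i n | lo u].
Proof.
elim: n => // n IH; rewrite !generationS.
rewrite (filter_lo_flatten _ children_immortal_lo); last first.
  move=> u hu; rewrite children_immortal_hi//= loN.
  by rewrite /hi /type_of/= /unzip1 map_rcons last_rcons; move: hu; rewrite /hi => ->.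
rewrite (filter_lo_flatten _ children_sterile_lo) ?IH// => u.
by move=> /children_sterile_hi ->.
Qed.

Lemma sterile_type_le i n u : (i <= m)%N -> u \in generation S i n -> (type_of u <= m)%N.
Proof.
move=> im; elim: n u => [u|n IH u]; first by rewrite inE => /eqP ->.
rewrite generationS => /flatten_mapP[v vn].
have [hv|lv] := boolP (hi v); first by rewrite children_sterile_hi.
move=> /mem_children[_ _ uv]; apply: (leq_trans uv).
by move: lv; rewrite -loN.
Qed.

Lemma Z_sterileE i n : (i <= m)%N -> Z S i n m = count hi (generation S i n).
Proof.
move=> im; apply: eq_in_count => u /(sterile_type_le im).
by rewrite /hi eqn_leq => ->.
Qed.

Lemma count_immortalS i n : (i <= m)%N ->
  count hi (generation I i n.+1) = (count hi (generation I i n) + Z S i n.+1 m)%N.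
Proof.
move=> im; rewrite Z_sterileE// !generationS.
have -> : count hi (flatten [seq children S u | u <- generation S i n]) =
    count hi (flatten [seq children off u | u <- generation S i n & lo u]).
  elim: (generation S i n) => //= u us IH; rewrite count_cat IH.
  have [hu|lu] := boolP (hi u); first by rewrite children_sterile_hi// loN hu.
  by rewrite loN lu /= count_cat children_sterile_lo// loN.
rewrite -filter_lo_generation.
elim: (generation I i n) => //= u us IH; rewrite count_cat IH.
have [hu|lu] := boolP (hi u).
  rewrite children_immortal_hi// loN hu /= addn0.
  by rewrite {1}/hi /type_of/= /unzip1 map_rcons last_rcons -/(type_of u) -/(hi u) hu addnA.
by rewrite loN lu /= count_cat children_immortal_lo ?loN// add0n addnCA.
Qed.

Lemma count_immortalE i n : (i <= m)%N ->
  count hi (generation I i n) = (\sum_(0 <= j < n.+1) Z S i j m)%N.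
Proof.
move=> im; elim: n => [|n IH]; first by rewrite big_nat1 Z_sterileE.
by rewrite count_immortalS// big_nat_recr//= IH.
Qed.

End SterileImmortal.

Section ExtendedExponential.
Context {R : realType}.
Implicit Types (a : R) (t : \bar R).

(* exp (- a t), extended by 0 at t = +oo (and by 1 at -oo, which never occurs). *)
Definition expneg a t : R := expR (- (a * fine t)) * (t < +oo)%E%:R.

Lemma expneg_fin a (r : R) : expneg a r%:E = expR (- (a * r)).
Proof. by rewrite /expneg/= ltry mulr1. Qed.

Lemma expneg_pinfty a : expneg a +oo%E = 0.
Proof. by rewrite /expneg ltxx mulr0. Qed.

Lemma expneg_ge0 a t : 0 <= expneg a t.
Proof. by rewrite /expneg mulr_ge0// expR_ge0. Qed.

Lemma expneg_le1 a t : 0 <= a -> (0 <= t)%E -> expneg a t <= 1.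
Proof.
move=> a0; case: t => [r||]//; rewrite ?expneg_pinfty// lee_fin expneg_fin => r0.
by rewrite -expR0 ler_expR oppr_le0 mulr_ge0.
Qed.

Lemma expneg_norm_le1 a t : 0 <= a -> (0 <= t)%E -> `|expneg a t| <= 1.
Proof. by move=> a0 t0; rewrite ger0_norm ?expneg_le1// expneg_ge0. Qed.

Lemma expneg_anti a b t : a <= b -> (0 <= t)%E -> expneg b t <= expneg a t.
Proof.
move=> ab; case: t => [r||]//; rewrite ?expneg_pinfty// lee_fin !expneg_fin => r0.
by rewrite ler_expR lerN2 ler_wpM2r.
Qed.

Lemma expneg_anti_lt a b t : a < b -> (0 < t < +oo)%E -> expneg b t < expneg a t.
Proof.
move=> ab; case: t => [r||]//; rewrite ?ltxx ?andbF// lte_fin !expneg_fin => /andP[r0 _].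
by rewrite ltr_expR ltrN2 ltr_pM2r.
Qed.

Lemma expneg_scale a c t : 0 < c -> expneg a (t * c%:E)%E = expneg (a * c) t.
Proof.
move=> c0; case: t => [r||]//.
- by rewrite -EFinM !expneg_fin; congr expR; ring.
- by rewrite gt0_mulye ?lte_fin// !expneg_pinfty.
- by rewrite gt0_mulNye ?lte_fin// /expneg/= !mulr0.
Qed.

Lemma expneg_cvg a (t_ : nat -> \bar R) t : 0 < a -> (0 <= t)%E ->
  t_ n @[n --> \oo] --> t -> expneg a (t_ n) @[n --> \oo] --> expneg a t.
Proof.
move=> a0; case: t => [r _ /fine_cvgP[tfin tr]|_ toy|//].
  rewrite expneg_fin; apply: (@cvg_trans _ (expR (- (a * fine (t_ n))) @[n --> \oo])).
    apply: near_eq_cvg; apply: filterS tfin => n nfin.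
    by rewrite -[in RHS](fineK nfin) expneg_fin.
  apply: (@cvg_comp _ _ _ (fun n => - (a * fine (t_ n))) expR _ (nbhs (- (a * r)))).
    by apply: cvgN; apply: cvgM; [exact: cvg_cst|exact: tr].
  exact: continuous_expR.
rewrite expneg_pinfty; apply/cvgr0Pnorm_le => e e0.
have [N _ hN] := (cvgeyPge _).1 toy (- (ln e) / a); exists N => // n /hN /= tn.
rewrite ger0_norm ?expneg_ge0//; case: (t_ n) tn => [r||//].
  rewrite lee_fin ler_pdivrMr// expneg_fin => h.
  by rewrite -[leRHS]lnK// ler_expR; lra.
by move=> _; rewrite expneg_pinfty; exact: ltW.
Qed.

Lemma expneg_measurable {d} {T : measurableType d} a (W : T -> \bar R) :
  measurable_fun setT W -> measurable_fun setT (fun w => expneg a (W w)).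
Proof.
move=> mW; apply: measurable_funM.
  apply: measurableT_comp => //; apply: measurableT_comp => //.
  by apply: measurable_funM => //; exact: measurableT_comp.
rewrite (_ : (fun w => _) = (\1_(W @^-1` (~` [set +oo%E])) : T -> R)).
  apply: measurable_indic; rewrite -[X in measurable X]setTI.
  by apply: mW => //; apply: measurableC; exact: emeasurable_set1.
apply/funext => w; rewrite indicE; congr (_ %:R); congr nat_of_bool.
rewrite ltey; apply/idP/idP => [/eqP h|]; first by rewrite inE.
by rewrite inE => /= h; apply/eqP.
Qed.

End ExtendedExponential.

Section Embedded.
Context {R : realType} {d : measure_display} {T : measurableType d}.
Context (P : probability T R) (p : nat -> (nat -> nat) -> R).
Context (X : label -> T -> nat -> nat) (X_lhbp : LHBP p P X).

Let N m n w := count (fun u => (m <= type_of u)%N) (immortal_gen X m 0 n w).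

Lemma embedded_cvg m w :
  (N m n w)%:R%:E @[n --> \oo] --> (embedded X 0 m w : \bar R).
Proof.
have h : (\sum_(0 <= n < k) (Z (sterile (m%:Z - 1) (X^~ w)) 0 n m)%:R%:E)%E @[k --> \oo]
    --> (embedded X 0 m w : \bar R).
  by apply: is_cvg_nneseries => n _ _; rewrite lee_fin.
rewrite -cvg_shiftS in h; apply: cvg_trans h; apply: near_eq_cvg; apply: nearW => n /=.
by rewrite sumEFin -natr_sum /N /immortal_gen count_immortalE.
Qed.

Lemma embedded_ge0 m w : (0 <= embedded X 0 m w :> \bar R)%E.
Proof. by apply: nneseries_ge0 => n _ _; rewrite lee_fin. Qed.

Lemma N_mono m w i j : (i <= j)%N -> (N m i w <= N m j w)%N.
Proof.
move=> ij; rewrite /N /immortal_gen !count_immortalE// [leqRHS](big_cat_nat (n := i.+1))//=.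
exact: leq_addr.
Qed.

Lemma embedded_ge1 m w : (0 < embedded X 0 m w :> \bar R)%E -> (1 <= embedded X 0 m w :> \bar R)%E.
Proof.
move=> Y0; have [[n Nn]|no] := pselect (exists n, (0 < N m n w)%N).
  rewrite -(cvg_lim (@ereal_hausdorff R) (@embedded_cvg m w)).
  apply: lime_ge; first by apply/cvg_ex; eexists; exact: embedded_cvg.
  exists n => // j /= nj; rewrite lee_fin ler1n; exact: leq_trans (N_mono m w nj).
suff E : embedded X 0 m w = (0%E : \bar R) by move: Y0; rewrite E ltxx.
apply: (cvg_unique (@ereal_hausdorff R) (@embedded_cvg m w)).
apply: cvg_near_cst; apply: nearW => n; suff -> : N m n w = 0%N by [].
by apply/eqP; rewrite -leqn0 leqNgt; apply/negP => h; apply: no; exists n.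
Qed.

Lemma embedded_measurable m : measurable_fun setT (embedded X 0 m : T -> \bar R).
Proof.
apply: (emeasurable_fun_cvg (fun n w => (N m n w)%:R%:E)).
  move=> n; apply/measurable_EFinP.
  exact: (immortal_gen_comp_meas X_lhbp m 0 n (fun s => (count (fun u => (m <= type_of u)%N) s)%:R)).
by move=> w _; exact: embedded_cvg.
Qed.

Lemma embedded_gf_expneg m (a : R) : 0 < a ->
  embedded_gf p m (expR (- a)) 0%N = \int[P]_w expneg a (embedded X 0 m w).
Proof.
move=> a0; set y := expR (- a).
have y01 : 0 <= y <= 1 by rewrite expR_ge0 -expR0 ler_expR oppr_le0 ltW.
have o01 : 0 <= (1 : R) <= 1 by rewrite ler01 lexx.
apply: (cvg_unique (@Rhausdorff R) (@embedded_gf_cvg _ _ _ P p X X_lhbp m y y01 0%N)).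
have := @Ex_dominated_cvg _ _ _ P (fun n w => expneg a (N m n w)%:R%:E) (fun w => expneg a (embedded X 0 m w)) 1.
have mN n : measurable_fun setT (fun w => expneg a (N m n w)%:R%:E).
  exact: (immortal_gen_comp_meas X_lhbp m 0 n (fun s => expneg a (count (fun u => (m <= type_of u)%N) s)%:R%:E)).
move=> /(_ mN (expneg_measurable a (embedded_measurable m))) h.
apply: cvg_trans (h _ _).
- apply: near_eq_cvg; apply: nearW => n.
  rewrite -(Ex_prod_immortal_gen X_lhbp m 0 n (cutvec_unit m o01 y01)).
  apply: eq_Rintegral => w _; rewrite prod_cutvec expneg_fin /y -expRM_natr.
  by congr expR; rewrite mulNr.
- by move=> n w; apply: expneg_norm_le1; [exact: ltW|rewrite lee_fin].
- by apply: nearW => w; apply: expneg_cvg => //; [exact: embedded_ge0|exact: embedded_cvg].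
Qed.

End Embedded.

Section Limit.
Context {R : realType} {d : measure_display} {T : measurableType d}.
Context (P : probability T R) (W : T -> \bar R) (mW : measurable_fun setT W)
  (W0 : forall w, (0 <= W w)%E).

Definition laplace (a : R) : R := \int[P]_w expneg a (W w).

Lemma bmfun_expneg a : 0 <= a -> bmfun (fun w => expneg a (W w)).
Proof.
move=> a0; split; first exact: expneg_measurable.
by exists 1 => w; exact: expneg_norm_le1.
Qed.

Lemma laplace_anti a b : 0 <= a -> a <= b -> laplace b <= laplace a.
Proof.
move=> a0 ab; apply: Ex_le; [apply: bmfun_expneg; exact: le_trans ab|exact: bmfun_expneg|].
by move=> w; exact: expneg_anti.
Qed.

Let mfin : measurable [set w | (W w < +oo)%E].
Proof.
rewrite (_ : [set w | _] = setT `&` W @^-1` (~` [set +oo%E])).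
  by apply: mW => //; apply: measurableC; exact: emeasurable_set1.
by rewrite setTI; apply/seteqP; split=> w /=; rewrite ltey => /eqP.
Qed.

(** The indicator of W < +oo is absorbed into a function f of W that vanishes at +oo; the same form
    then serves z = exp(- a), z = 1 and z = 0. *)
Lemma gW_integral z (f : \bar R -> R) :
  (forall r : R, 0 <= r -> z `^ r = f r%:E) -> f +oo%E = 0 ->
  gW P W z = (\int[P]_w (f (W w))%:E)%E.
Proof.
move=> zf foo; rewrite /gW integral_mkcond; apply: eq_integral => w _; rewrite patchE.
have := W0 w; case: ifPn => [|]; rewrite ?inE ?notin_setE /=.
  by case: (W w) => [r||]//; rewrite lee_fin => _ r0; rewrite zf.
case: (W w) => [r||]//; first by rewrite ltry.
by rewrite foo.
Qed.

Lemma gW_laplace a : 0 <= a -> gW P W (expR (- a)) = (laplace a)%:E.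
Proof.
move=> a0; rewrite EFin_Ex; last exact: bmfun_expneg.
apply: gW_integral; last exact: expneg_pinfty.
by move=> r r0; rewrite expneg_fin /powR gt_eqF ?expR_gt0// expRK mulrC mulNr.
Qed.

(** As a tends to 0, [laplace] tends to P(W < +oo) = g_W(1). With its counterpart at infinity, whose
    limit is P(W = 0) = g_W(0) because 0^0 = 1, it provides the end points for the intermediate
    value theorem. *)
Lemma gW1_lt (s : R) : (s%:E < gW P W 1)%E -> exists2 a, 0 < a & s < laplace a.
Proof.
pose f (t : \bar R) : R := (t < +oo)%E%:R.
have fE : (fun w => f (W w)) = \1_[set w | (W w < +oo)%E].
  apply/funext => w; rewrite indicE /f; congr (_ %:R); congr nat_of_bool.
  by apply/idP/idP; rewrite inE.
have bf : bmfun (fun w => f (W w)) by rewrite fE; exact: bmfun_indic.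
rewrite (gW_integral (f := f)); last 2 first.
- by move=> r _; rewrite powR1 /f ltry.
- by rewrite /f ltxx.
rewrite -EFin_Ex// lte_fin => sf.
have h : laplace (n.+1%:R^-1) @[n --> \oo] --> \int[P]_w f (W w).
  apply: (Ex_dominated_cvg (M := 1)).
  - by move=> n; exact: expneg_measurable.
  - by have [] := bf.
  - by move=> n w; exact: expneg_norm_le1.
  apply: nearW => w; have := W0 w; case: (W w) => [r||]// r0; last first.
    by rewrite /f ltxx; under eq_fun do rewrite expneg_pinfty; exact: cvg_cst.
  have h : expR (- (n.+1%:R^-1 * r)) @[n --> \oo] --> expR (- (0 * r)).
    apply: (@cvg_comp _ _ _ (fun n => - (n.+1%:R^-1 * r)) expR _ (nbhs (- (0 * r)))).
      apply: cvgN; apply: cvgM; last exact: cvg_cst.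
      exact: cvg_harmonic.
    exact: continuous_expR.
  rewrite mul0r oppr0 expR0 in h; rewrite /f ltry; apply: cvg_trans h.
  by apply: near_eq_cvg; apply: nearW => n; rewrite expneg_fin.
have [n _ /(_ n (leqnn n)) hn] := cvgr_gt _ h _ sf.
by exists (n.+1%:R^-1) => //; rewrite invr_gt0.
Qed.

Lemma gW0_gt (s : R) : (gW P W 0 < s%:E)%E -> exists2 a, 0 < a & laplace a < s.
Proof.
pose f (t : \bar R) : R := (t == 0%E)%:R.
have fE : (fun w => f (W w)) = \1_(W @^-1` [set 0%E]).
  apply/funext => w; rewrite indicE /f; congr (_ %:R); congr nat_of_bool.
  by apply/eqP/idP; rewrite inE.
have bf : bmfun (fun w => f (W w)).
  rewrite fE; apply: bmfun_indic; rewrite -[X in measurable X]setTI.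
  by apply: mW => //; exact: emeasurable_set1.
rewrite (gW_integral (f := f)); last 2 first.
- move=> r r0; rewrite /f eqe; have [->|rn] := eqVneq r 0; first by rewrite powRr0.
  by rewrite powR0.
- by rewrite /f.
rewrite -EFin_Ex// lte_fin => sf.
have h : laplace n.+1%:R @[n --> \oo] --> \int[P]_w f (W w).
  apply: (Ex_dominated_cvg (M := 1)).
  - by move=> n; exact: expneg_measurable.
  - by have [] := bf.
  - by move=> n w; exact: expneg_norm_le1.
  apply: nearW => w; have := W0 w; case: (W w) => [r||]// r0; last first.
    by rewrite /f; under eq_fun do rewrite expneg_pinfty; exact: cvg_cst.
  rewrite /f eqe; have [->|rn] := eqVneq r 0.
    by under eq_fun do rewrite expneg_fin mulr0 oppr0 expR0; exact: cvg_cst.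
  rewrite lee_fin in r0; have {}r0 : 0 < r by rewrite lt_def rn.
  have x1 : `|expR (- r)| < 1 by rewrite ger0_norm ?expR_ge0// -expR0 ltr_expR oppr_lt0.
  have := cvg_expr x1; rewrite -cvg_shiftS; apply: cvg_trans.
  apply: near_eq_cvg; apply: nearW => n /=.
  by rewrite expneg_fin -expRM_natl mulrN.
have [n _ /(_ n (leqnn n)) hn] := cvgr_lt _ h _ sf.
by exists n.+1%:R.
Qed.

Lemma laplace_continuous a b : 0 < a -> a <= b -> {within `[a, b], continuous laplace}.
Proof.
move=> a0 ab.
have := @continuity_under_integral R d T P (fun a w => expneg a (W w)) setT measurableT 0 (b + 1)
  _ _ (cst 1) _ _.
move=> /(_ _ _ _ _) h; apply: continuous_in_subspaceT => x; rewrite inE /= in_itv/= => /andP[ax xb].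
apply: h.
- move=> y /=; rewrite in_itv/= => /andP[y0 _]; apply: bmfun_integrable.
  by apply: bmfun_expneg; exact: ltW.
- apply: nearW => w _ y _; have := W0 w; case: (W w) => [r||]// _; last first.
    rewrite (_ : expneg^~ _ = fun=> 0); first exact: cst_continuous.
    by apply/funext => t; rewrite expneg_pinfty.
  rewrite (_ : expneg^~ _ = fun t => expR (- (t * r))); last first.
    by apply/funext => t; rewrite expneg_fin.
  apply: (@cvg_comp _ _ _ (fun t => - (t * r)) expR _ (nbhs (- (y * r)))).
    by apply: cvgN; apply: cvgMl; exact: cvg_id.
  exact: continuous_expR.
- exact: (bmfun_integrable P (bmfun_cst 1)).
- move=> y /=; rewrite in_itv/= => /andP[y0 _]; apply: nearW => w _.
  by apply: expneg_norm_le1 => //; exact: ltW.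
- by rewrite inE /= in_itv/=; lra.
Qed.

Lemma measurable_pos_fin : measurable [set w | (0 < W w < +oo)%E].
Proof.
rewrite (_ : [set w | _] = setT `&` W @^-1` (~` [set +oo%E] `&` ~` [set 0%E])).
  by apply: mW => //; apply: measurableI; apply: measurableC; exact: emeasurable_set1.
rewrite setTI; apply/seteqP; split=> w /=.
  by rewrite lt_neqAle ltey => /andP[/andP[/eqP h1 _] /eqP h2]; split=> // h; apply: h1.
by move=> [/eqP h1 /eqP h2]; rewrite ltey h1 andbT lt_neqAle W0 andbT eq_sym.
Qed.

Context (Wpos : (0 < P [set w | (0 < W w < +oo)%E])%E).

(** Equality would make the two exponentials agree almost surely, yet they differ wherever 0 < W <
    +oo. *)
Lemma laplace_anti_lt a b : 0 < a -> a < b -> laplace b < laplace a.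
Proof.
move=> a0 ab; have a0' := ltW a0; have b0' : 0 <= b by rewrite ltW// (lt_trans a0).
rewrite lt_neqAle laplace_anti ?ltW// andbT; apply/negP => /eqP E.
pose f w := expneg a (W w) - expneg b (W w).
have bf : bmfun f by apply: bmfunB; exact: bmfun_expneg.
have f0 w : 0 <= f w by rewrite subr_ge0 expneg_anti// ltW.
have : (\int[P]_w `|(f w)%:E| = 0)%E.
  under eq_integral => w _ do rewrite gee0_abs ?lee_fin//.
  rewrite -EFin_Ex// /f ExB; [|exact: bmfun_expneg|exact: bmfun_expneg].
  by rewrite -/(laplace a) -/(laplace b) E subrr.
have mf : measurable_fun setT (EFin \o f) by apply/measurable_EFinP; have [] := bf.
move=> h0; have [A [mA PA subA]] := (ae_eq_integral_abs P measurableT mf).1 h0.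
have : (P [set w | (0 < W w < +oo)%E] <= P A)%E.
  apply: le_measure; rewrite ?inE//; first exact: measurable_pos_fin.
  move=> w /= Ww; apply: subA => /= /(_ I) /eqP.
  by rewrite eqe subr_eq0 => /eqP h; have := expneg_anti_lt ab Ww; rewrite h ltxx.
by rewrite PA leNgt Wpos.
Qed.

End Limit.

(** * Growth rates *)

Lemma frequently_subsequence (Q : nat -> Prop) :
  (forall N, exists2 k, (N <= k)%N & Q k) ->
  exists2 f : nat -> nat, (forall j, (f j < f j.+1)%N) & forall j, Q (f j).
Proof.
move=> Qfreq; have /boolp.choice[g gP] : forall N, exists k, (N <= k)%N /\ Q k.
  by move=> N; have [k ? ?] := Qfreq N; exists k.
pose f := fix f j := if j is j'.+1 then g (f j').+1 else g 0%N.
exists f => [j|[|j]] /=; [exact: (gP _).1|exact: (gP _).2..].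
Qed.

Lemma strictly_increasing_le (f : nat -> nat) i j :
  (forall k, (f k < f k.+1)%N) -> (i <= j)%N -> (f i <= f j)%N.
Proof.
move=> fS; elim: j => [|j IH]; first by rewrite leqn0 => /eqP ->.
rewrite leq_eqVlt => /predU1P[->//|ij]; exact: leq_trans (IH ij) (ltnW (fS j)).
Qed.

Lemma strictly_increasing_ge (f : nat -> nat) j : (forall k, (f k < f k.+1)%N) -> (j <= f j)%N.
Proof. by move=> fS; elim: j => // j IH; exact: leq_ltn_trans IH (fS j). Qed.

Lemma one_sub_expR_le {R : realType} (x : R) : 0 <= x -> x - x ^+ 2 <= 1 - expR (- x) <= x.
Proof.
move=> x0; have h := expR_ge1Dx (- x); have h' := expR_ge1Dx x.
apply/andP; split; last by lra.
have e0 := expR_gt0 (- x).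
have E : expR (- x) * expR x = 1 by rewrite -expRD addNr expR0.
have : expR (- x) * (1 + x) <= 1 by rewrite -[leRHS]E ler_pM2l.
have x3 : 0 <= x ^+ 3 by rewrite exprn_ge0.
have x1 : 0 < 1 + x by lra.
move=> h1; rewrite -(ler_pM2r x1).
have -> : (x - x ^+ 2) * (1 + x) = x - x ^+ 3 by ring.
lra.
Qed.

Section Growth.
Context {R : realType} {d : measure_display} {T : measurableType d}.
Context (P : probability T R) (p : nat -> (nat -> nat) -> R).
Context (X : label -> T -> nat -> nat) (p_law : offspring_law p) (X_lhbp : LHBP p P X).
Context (M_up : forall i, (0 < mean_progeny p i i.+1)%E) (X_dich : dichotomy P X).
Context (C : nat -> R) (W : T -> \bar R) (C_growth : growth_rate P X C W).

Let mW : measurable_fun setT W. Proof. by have [] := C_growth. Qed.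
Let W0 w : (0 <= W w)%E. Proof. by have [] := C_growth. Qed.
Let Wpos : (0 < P [set w | (0 < W w < +oo)%E])%E. Proof. by have [] := C_growth. Qed.

(** The definition leaves the sign of C_k open. At one outcome with W = r in (0, +oo), Y_k / C_k
    eventually lies in (0, r + 1); as Y_k is a count, it is then at least 1, so C_k >= 1 / (r +
    1). *)
Lemma growth_rate_ge : exists2 c0, 0 < c0 & \forall k \near \oo, c0 <= C k.
Proof.
have [w [Ww Cw]] : exists w, (0 < W w < +oo)%E /\
    (embedded X 0 k w * ((C k)^-1)%:E)%E @[k --> \oo] --> W w.
  apply: contrapT => no; have [_ _ [A [mA PA subA]] _] := C_growth.
  have mS := measurable_pos_fin mW W0.
  have : (P [set w | (0 < W w < +oo)%E] <= P A)%E.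
    apply: le_measure; rewrite ?inE// => w /= Ww; apply: subA => /= Cw.
    by apply: no; exists w.
  by rewrite PA leNgt Wpos.
move: Ww Cw; case: (W w) => [r||]; rewrite ?ltxx ?andbF// lte_fin => /andP[r0 _].
move=> /fine_cvgP[fn fr].
exists (r + 1)^-1; first by rewrite invr_gt0; lra.
have h1 := cvgr_gt _ fr _ r0; have h2 := cvgr_lt _ fr _ (_ : r < r + 1).
have [N1 _ HN1] := fn; have [N2 _ HN2] := h1; have [|N3 _ HN3] := h2; first by lra.
exists (maxn N1 (maxn N2 N3)) => // k /=; rewrite !geq_max => /and3P[k1 k2 k3].
have := HN1 k k1; have := HN2 k k2; have := HN3 k k3; rewrite /=.
have Y0 : (0 <= embedded X 0 k w :> \bar R)%E by exact: embedded_ge0.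
have Y1 : (0 < embedded X 0 k w :> \bar R)%E -> (1 <= embedded X 0 k w :> \bar R)%E.
  exact: embedded_ge1.
case: (embedded X 0 k w) Y0 Y1 => [y||]//.
- rewrite !lee_fin lte_fin => y0 y1; rewrite -EFinM/= => hlt hgt _.
  have yn : y != 0 by apply/eqP => yE; move: hgt; rewrite yE mul0r ltxx.
  have {}y0 : 0 < y by rewrite lt_def yn y0.
  have Ci : 0 < (C k)^-1 by rewrite -(pmulr_rgt0 _ y0).
  have C0 : 0 < C k by rewrite -invr_gt0.
  rewrite -[leRHS]invrK lef_pV2 ?posrE//; last by lra.
  apply: le_trans (ltW hlt); rewrite ler_peMl ?y1//; exact: ltW.
(* If Y_k = +oo, the quotient is infinite or, for a zero inverse, 0. Its [fine] is 0 in all cases,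
   against the strict lower bound. *)
- move=> _ _; have [C0|C0|<-] := ltgtP 0 (C k)^-1.
  + by rewrite gt0_mulye ?lte_fin//= ltxx.
  + by rewrite lt0_mulye ?lte_fin//= ltxx.
  + by rewrite mule0/= ltxx.
Qed.

Lemma growth_rate_gt0 : \forall k \near \oo, 0 < C k.
Proof.
have [c0 c0p [N _ HN]] := growth_rate_ge.
by exists N => // k /HN; exact: lt_le_trans.
Qed.

Lemma embedded_gf_growth_cvg (a : R) : 0 < a ->
  embedded_gf p k (expR (- (a / C k))) 0%N @[k --> \oo] --> laplace P W a.
Proof.
move=> a0.
(* The absolute value keeps the exponent nonnegative for every k, so that 1 dominates; it changes
   nothing once C_k > 0. *)
pose f k w := expneg a (embedded X 0 k w * (`|C k|^-1)%:E)%E.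
have t0 k w : (0 <= embedded X 0 k w * (`|C k|^-1)%:E)%E.
  by rewrite mule_ge0 ?embedded_ge0// lee_fin invr_ge0.
have [N _ HN] := growth_rate_gt0.
have fcvg : \int[P]_w f k w @[k --> \oo] --> laplace P W a.
  apply: (Ex_dominated_cvg (M := 1)).
  - move=> k; apply: expneg_measurable; apply: emeasurable_funM => //.
    exact: (embedded_measurable X_lhbp).
  - exact: expneg_measurable.
  - by move=> k w; apply: expneg_norm_le1 => //; exact: ltW.
  have [_ _ + _] := C_growth; apply: filterS => w Cw.
  apply: expneg_cvg => //; apply: cvg_trans Cw; apply: near_eq_cvg.
  by exists N => // k /HN Ck; rewrite gtr0_norm.
apply: cvg_trans fcvg; apply: near_eq_cvg; exists N => // k /HN /= Ck.
rewrite (embedded_gf_expneg X_lhbp) ?divr_gt0//; apply: eq_Rintegral => w _.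
by rewrite /f gtr0_norm// expneg_scale ?invr_gt0.
Qed.

Context (p1_div : (\sum_(0 <= i <oo) (1 - p1 p i) = +oo)%E).

Lemma expR_neg_01 (a : R) : 0 <= a -> 0 <= expR (- a) <= 1.
Proof. by move=> a0; rewrite expR_ge0 -expR0 ler_expR oppr_le0. Qed.

(* Along a subsequence with C -> L < oo, E_0[exp(- x Y_k)] would converge to the
   strictly decreasing function x |-> laplace P W (x * L), hence separate. *)
Lemma growth_rate_cvgy : C k @[k --> \oo] --> +oo.
Proof.
apply: contrapT => /cvgryPge noC.
have [A noA] : exists A, ~ \forall k \near \oo, A <= C k.
  by apply: contrapT => no; apply: noC => A; apply: contrapT => h; apply: no; exists A.
have [c0 c0p [N0 _ HN0]] := growth_rate_ge.
have [f0 f0S f0P] : exists2 f : nat -> nat, (forall j, (f j < f j.+1)%N) &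
    forall j, c0 <= C (f j) <= A.
  apply: (@frequently_subsequence (fun k => c0 <= C k <= A)) => N; apply: contrapT => no; apply: noA.
  exists (maxn N N0); first by [].
  move=> k /=; rewrite geq_max => /andP[Nk N0k].
  rewrite leNgt; apply/negP => CA; apply: no; exists k => //.
  by rewrite HN0//= ltW.
have bC : bounded_fun (C \o f0).
  exists `|A|; split; [exact: num_real|move=> x Ax j _ /=].
  have /andP[c1 c2] := f0P j; rewrite ger0_norm; last by rewrite (le_trans (ltW c0p)).
  by rewrite (le_trans c2)// (le_trans (ler_norm A))// ltW.
have [g /increasing_seqP gS /cvg_ex[/= L CL]] := bolzano_weierstrass bC.
pose f := f0 \o g.
have fS j : (f j < f j.+1)%N.
  rewrite /f/=; apply: (leq_trans (f0S (g j))); apply: (strictly_increasing_le f0S).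
  by have := gS j; rewrite ltEnat.
have L0 : 0 < L.
  apply: (lt_le_trans c0p); apply: (cvgr_to_ge CL); apply: nearW => j.
  by have /andP[] := f0P (g j).
apply: (@no_separation R _ _ P p X p_law X_lhbp M_up X_dich p1_div f).
- by move=> j; exact: strictly_increasing_ge.
- by move=> i j; exact: strictly_increasing_le.
move=> a b a0 ab b1; have b0 : 0 < b by exact: lt_trans ab.
pose x := - ln a; pose y := - ln b.
have aE : a = expR (- x) by rewrite /x opprK lnK.
have bE : b = expR (- y) by rewrite /y opprK lnK.
have y0 : 0 < y by rewrite /y oppr_gt0 ln_lt0// b0.
have yx : y < x by rewrite /x /y ltrN2 ltr_ln.
(* l1 and l2 cut the interval from y L to x L into thirds. As C tends to L along f, eventually y <
   l1 / C and l2 / C < x. *)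
pose l1 := y * L + (x - y) * L / 3; pose l2 := y * L + (x - y) * L * 2 / 3.
have xyL : 0 < (x - y) * L by rewrite mulr_gt0// subr_gt0.
have yL : 0 < y * L by rewrite mulr_gt0.
have l12 : l1 < l2 by rewrite /l1 /l2; lra.
have l10 : 0 < l1 by rewrite /l1; lra.
have l20 : 0 < l2 by rewrite (lt_trans l10).
have laplace12 := laplace_anti_lt mW W0 Wpos l10 l12.
(* A fixed level between the two limits lets the indices j and l vary independently. *)
pose mid := (laplace P W l1 + laplace P W l2) / 2.
have m1 : mid < laplace P W l1 by rewrite /mid; lra.
have m2 : laplace P W l2 < mid by rewrite /mid; lra.
have [N1 _ HN1] := cvgr_gt _ (embedded_gf_growth_cvg l10) _ m1.
have [N2 _ HN2] := cvgr_lt _ (embedded_gf_growth_cvg l20) _ m2.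
have Ly : L < l1 / y by rewrite ltr_pdivlMr// mulrC /l1; lra.
have x0 : 0 < x by exact: lt_trans yx.
have Lx : l2 / x < L by rewrite ltr_pdivrMr// /l2; lra.
have [N3 _ HN3] := cvgr_lt _ CL _ Ly; have [N4 _ HN4] := cvgr_gt _ CL _ Lx.
exists (maxn (maxn N1 N2) (maxn N3 N4)) => j l.
rewrite !geq_max => /andP[/andP[N1j N2j] /andP[N3j N4j]] /andP[/andP[N1l N2l] /andP[N3l N4l]].
have Cp i : 0 < C (f i) by have /andP[h _] := f0P (g i); exact: lt_le_trans h.
have h1 := HN1 (f l) (leq_trans N1l (strictly_increasing_ge l fS)).
have h2 := HN2 (f j) (leq_trans N2j (strictly_increasing_ge j fS)).
apply: (@le_lt_trans _ _ (embedded_gf p (f j) (expR (- (l2 / C (f j)))) 0%N)).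
  apply: (embedded_gf_mono X_lhbp) => //; rewrite ?aE.
  + by apply: expR_neg_01; exact: ltW.
  + by apply: expR_neg_01; rewrite ltW// divr_gt0.
  rewrite ler_expR lerN2 ler_pdivrMr// mulrC -ler_pdivrMr//; apply: ltW; exact: HN4.
apply: (lt_le_trans (lt_trans h2 h1)).
apply: (embedded_gf_mono X_lhbp) => //; rewrite ?bE.
+ by apply: expR_neg_01; rewrite ltW// divr_gt0.
+ by apply: expR_neg_01; exact: ltW.
rewrite ler_expR lerN2 ler_pdivlMr// mulrC -ler_pdivlMr//; apply: ltW; exact: HN3.
Qed.

End Growth.

(** * Asymptotics of a fixed point *)

Lemma fixed_point_lt1 {R : realType} {d : measure_display} {T : measurableType d}
    (P : probability T R) (p : nat -> (nat -> nat) -> R) (X : label -> T -> nat -> nat)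
    (s : nat -> R) :
  offspring_law p -> LHBP p P X -> irreducible_law p ->
  (fixed_points p `\ (fun=> 1)) s -> forall i, s i < 1.
Proof.
move=> p_law X_lhbp p_irr [[s01 sG] s1] i.
have [j sj] : exists j, s j < 1.
  apply: contrapT => no; apply: s1; apply/funext => j; apply/eqP.
  have /andP[_ sj1] := s01 j; rewrite eq_le sj1 leNgt; apply/negP => sj.
  by apply: no; exists j.
have [w [pw lw]] := p_irr i j.
(* Along the path from i to j the strict inequality travels backwards: an edge from i to k with s k
   < 1 forces G_i(s) < 1. *)
elim: w i pw lw => [i _ /= ->//|k w IH i /= /andP[Mik pw] lw].
have sk := IH k pw lw.
have -> : s i = offspring_gf p i s by rewrite /offspring_gf -sG.
exact: (offspring_gf_lt1 p_law X_lhbp s01 Mik sk).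
Qed.

Theorem theorem4 (R : realType) (d : measure_display) (T : measurableType d)
    (P : probability T R) (p : nat -> (nat -> nat) -> R)
    (X : label -> T -> nat -> nat)
    (p_law : offspring_law p)
    (X_lhbp : LHBP p P X)
    (p_irr : irreducible_law p)
    (p_nonsing : nonsingular_law p)
    (M_up : forall i, (0 < mean_progeny p i i.+1)%E)
    (X_dich : dichotomy P X)
    (p1_div : (\sum_(0 <= i <oo) (1 - p1 p i) = +oo)%E)
    (s : nat -> R)
    (s_fix : (fixed_points p `\ (fun=> 1)) s)
    (C : nat -> R) (W : T -> \bar R)
    (C_growth : growth_rate P X C W)
    (s0_bounds : (gW P W 0 < (s 0%N)%:E < gW P W 1)%E) :
  exists c : R,
    [/\ 0 < c,
        (s 0%N)%:E = gW P W (expR (- c))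
      & (1 - s k) * C k @[k --> \oo] --> c].
Proof.
have s_lt1 := fixed_point_lt1 p_law X_lhbp p_irr s_fix.
have [s01 sG] := s_fix.1.
have [mW W0 _ Wpos] := C_growth.
have /andP[s_gt s_lt] := s0_bounds.
have [a a0 sa] := gW1_lt mW W0 s_lt; have [b b0 sb] := gW0_gt mW W0 s_gt.
have ab : a <= b.
  rewrite leNgt; apply/negP => /ltW ba.
  by have := laplace_anti P mW W0 (ltW b0) ba; lra.
have [|c] := @IVT R (laplace P W) a b (s 0%N) ab (laplace_continuous mW W0 a0 ab).
  by rewrite ge_min le_max (ltW sa) (ltW sb) orbT.
rewrite in_itv/= => /andP[ac cb] laplacec.
have c0 : 0 < c by exact: lt_le_trans ac.
exists c; split=> //; first by rewrite gW_laplace ?laplacec// ltW.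
have C_y := growth_rate_cvgy p_law X_lhbp M_up X_dich C_growth p1_div.
have s0E k : s 0%N = embedded_gf p k (s k) 0%N.
  apply: (embedded_gf_unique p_law X_lhbp M_up X_dich) => // i _.
  by rewrite /offspring_gf -sG.
have sk_ub (l : R) : 0 < l -> l < c -> \forall k \near \oo, s k < expR (- (l / C k)).
  move=> l0 lc; have [N1 _ HN1] := growth_rate_gt0 C_growth.
  have pl := laplace_anti_lt mW W0 Wpos l0 lc; rewrite laplacec in pl.
  have [N2 _ HN2] := cvgr_gt _ (embedded_gf_growth_cvg X_lhbp C_growth l0) _ pl.
  exists (maxn N1 N2) => // k /=; rewrite geq_max => /andP[/HN1 Ck /HN2 /=].
  rewrite {1}(s0E k); apply: contraTT; rewrite -!leNgt => h; apply: (embedded_gf_mono X_lhbp) => //.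
  by apply: expR_neg_01; rewrite ltW// divr_gt0.
have sk_lb l : c < l -> \forall k \near \oo, expR (- (l / C k)) < s k.
  move=> cl; have l0 : 0 < l by exact: lt_trans cl.
  have [N1 _ HN1] := growth_rate_gt0 C_growth.
  have pl := laplace_anti_lt mW W0 Wpos c0 cl; rewrite laplacec in pl.
  have [N2 _ HN2] := cvgr_lt _ (embedded_gf_growth_cvg X_lhbp C_growth l0) _ pl.
  exists (maxn N1 N2) => // k /=; rewrite geq_max => /andP[/HN1 Ck /HN2 /=].
  rewrite {1}(s0E k); apply: contraTT; rewrite -!leNgt => h; apply: (embedded_gf_mono X_lhbp) => //.
  by apply: expR_neg_01; rewrite ltW// divr_gt0.
apply/cvgrPdist_le => e e0.
have [N1 _ HN1] := growth_rate_gt0 C_growth.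
have ce : c < c + e by lra.
have [N2 _ HN2] := sk_lb (c + e) ce.
(* c - e / 2 is the intended value; c / 2 keeps l positive when e is large. *)
pose l : R := Order.max (c - e / 2) (c / 2).
have l0 : 0 < l by rewrite lt_max; apply/orP; right; lra.
have lc : l < c by rewrite gt_max; apply/andP; split; lra.
have le : c - e / 2 <= l by rewrite le_max lexx.
have [N3 _ HN3] := sk_ub l l0 lc.
(* The quadratic term in 1 - exp(- x) >= x - x^2 at x = l / C_k costs l^2 / C_k after multiplication
   by C_k; this threshold makes it at most e / 2. *)
have [N4 _ HN4] := (cvgryPge _).1 C_y (2 * l ^+ 2 / e).
exists (maxn (maxn N1 N2) (maxn N3 N4)) => // k /=.
rewrite !geq_max => /andP[/andP[/HN1 /= Ck /HN2 /= k2] /andP[/HN3 /= k3 /HN4 /= k4]].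
have Cn : C k != 0 by rewrite gt_eqF.
have ub : (1 - s k) * C k <= c + e.
  have x0 : 0 <= (c + e) / C k by apply: divr_ge0; apply: ltW => //; exact: lt_trans ce.
  have /andP[_ h] := one_sub_expR_le x0.
  have : (1 - s k) * C k <= (c + e) / C k * C k by rewrite ler_pM2r//; lra.
  by rewrite divfK.
have lb : c - e <= (1 - s k) * C k.
  have x0 : 0 <= l / C k by apply: divr_ge0; exact: ltW.
  have /andP[h _] := one_sub_expR_le x0.
  have : (l / C k - (l / C k) ^+ 2) * C k <= (1 - s k) * C k by rewrite ler_pM2r//; lra.
  have -> : (l / C k - (l / C k) ^+ 2) * C k = l - l ^+ 2 / C k by field.
  have : l ^+ 2 / C k <= e / 2.
    by move: k4; rewrite !ler_pdivrMr// => k4; lra.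
  by lra.
by rewrite ler_norml; apply/andP; split; lra.
Qed.
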